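(* Let $G$ and $H$ be two groups. Then for all $c\ge 1$ there is an isomorphism $$M^{(c)}(G\ast H)\cong M^{(c)}(G)\oplus M^{(c)}(H)$$ if one of the following conditions holds: (i) $G$ and $H$ are two finite abelian groups with coprime orders; (ii) $G$ and $H$ are two finite groups with $\big(|G|,|H^{ab}|\big)=\big(|G^{ab}|,|H|\big)=1$; (iii) $G$ and $H$ are two finite groups with $\big(|G^{ab}|,|H^{ab}|\big)=\big(|M(G)|,|H^{ab}|\big)=\big(|G^{ab}|,|M(H)|\big)=1$; (iv) $G$ and $H$ are two perfect groups.
   Context: For a group $G$ with free presentation $G\cong F/R$ ($F$ a free group, $R$ a normal subgroup) and an integer $c\ge 1$, the $c$-nilpotent multiplier of $G$ is $$M^{(c)}(G)=\frac{R\cap\gamma_{c+1}(F)}{[R,\ {}_cF]},$$ where $\gamma_{c+1}(F)$ is the $(c+1)$-st term of the lower central series of $F$ (with $\gamma_1(F)=F$), $[R,\ {}_1F]=[R,F]$ and inductively $[R,\ {}_cF]=[[R,\ {}_{c-1}F],F]$. It is an abelian group which, up to isomorphism, does not depend on the chosen free presentation. $M(G)=M^{(1)}(G)$ is the Schur multiplier of $G$, isomorphic to $H_2(G,\mathbb{Z})$. $G\ast H$ denotes the free product, $G^{ab}$ the abelianization of $G$, $|\cdot|$ the order of a finite group, and $(a,b)$ the greatest common divisor of the integers $a,b$. A group is perfect if it equals its own commutator subgroup. *)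

(* Defs.v *)
From HB Require Import structures.
From mathcomp Require Import all_boot.
From mathcomp Require Import finmap.
From mathcomp Require Import boolp classical_sets functions cardinality.
Set Implicit Arguments.
Unset Strict Implicit.
Unset Printing Implicit Defensive.
Import Algebra.
Local Open Scope classical_set_scope.
Local Open Scope quotient_scope.
Local Open Scope group_scope.

(* Groups are MathComp's [groupType]s, which may be infinite. *)

Notation group_hom := UMagmaMorphism.type.

Definition isomorphic (G H : groupType) : Prop :=
  exists f : group_hom G H, bijective f.

Definition abelian_group (G : groupType) : Prop :=
  forall x y : G, x * y = y * x.

Definition finite_group (G : groupType) : Prop := finite_set [set: G].

(* The order of a finite group; the value is 0 when G is infinite. *)
Definition group_order (G : groupType) : nat := #|` fset_set [set: G]|%fset.

Identity Coercion fun_of_set : set >-> Funclass.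

Section Subgroups.
Variable G : groupType.

Definition is_subgroup (A : set G) : Prop :=
  A 1 /\ (forall x y, A x -> A y -> A (x / y)).

Record subgroup := Subgroup {
  subgroup_set :> set G;
  subgroupP : is_subgroup subgroup_set }.

Record normal_subgroup := NormalSubgroup {
  normal_sub :> subgroup;
  normalP : forall x y, normal_sub x -> normal_sub (x ^ y) }.

Lemma subgroup1 (A : subgroup) : A 1.
Proof. by case: (subgroupP A). Qed.

Lemma subgroupF (A : subgroup) x y : A x -> A y -> A (x / y).
Proof. by case: (subgroupP A) => _; apply. Qed.

Lemma subgroupV (A : subgroup) x : A x -> A x^-1.
Proof.
by move=> Ax; rewrite -(mul1g x^-1); apply: subgroupF => //; exact: subgroup1.
Qed.

Lemma subgroupM (A : subgroup) x y : A x -> A y -> A (x * y).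
Proof.
by move=> Ax Ay; rewrite -(invgK y); apply: subgroupF => //; exact: subgroupV.
Qed.

Definition generated (S : set G) : set G := smallest is_subgroup S.

Lemma generated_is_subgroup S : is_subgroup (generated S).
Proof.
split=> [A [[A1 _] _] //|x y Sx Sy A [sA SA]].
by apply: (proj2 sA); [apply: Sx|apply: Sy].
Qed.

Definition comm_set (A B : set G) : set G :=
  generated [set [~ a, b] | a in A & b in B].

Lemma comm_set_normal (A B : normal_subgroup) x y :
  comm_set A B x -> comm_set A B (x ^ y).
Proof.
have [s1 sF] := generated_is_subgroup [set [~ a, b] | a in A & b in B].
apply: (@smallest_sub _ _ _ [set x | comm_set A B (x ^ y)]).
  split=> [|u v Au Av] /=; first by rewrite conj1g.
  by rewrite conjMg conjVg; apply: sF.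
move=> _ [a Aa [b Bb <-]] /=; rewrite conjRg.
by apply: sub_gen_smallest; exists (a ^ y); [|exists (b ^ y)] => //;
  exact: normalP.
Qed.

Definition comm (A B : normal_subgroup) : normal_subgroup :=
  @NormalSubgroup (Subgroup (generated_is_subgroup _)) (@comm_set_normal A B).

Lemma whole_is_subgroup : is_subgroup [set: G].
Proof. by []. Qed.

Definition whole : normal_subgroup :=
  @NormalSubgroup (Subgroup whole_is_subgroup) (fun _ _ _ => I).

Lemma meet_is_subgroup (A B : subgroup) : is_subgroup (A `&` B).
Proof.
split=> [|x y [Ax Bx] [Ay By]]; split; by [exact: subgroup1|exact: subgroupF].
Qed.

Lemma meet_normal (A B : normal_subgroup) x y :
  (A `&` B) x -> (A `&` B) (x ^ y).
Proof. by move=> [Ax Bx]; split; exact: normalP. Qed.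

Definition meet (A B : normal_subgroup) : normal_subgroup :=
  @NormalSubgroup (Subgroup (meet_is_subgroup A B)) (@meet_normal A B).

(* [R, _c G] *)
Definition iter_comm (R : normal_subgroup) (c : nat) : normal_subgroup :=
  iter c (comm ^~ whole) R.

(* gamma_n(G), indexed from gamma_1(G) = G; the value at n = 0 is also G. *)
Definition lower_central (n : nat) : normal_subgroup := iter_comm whole n.-1.

Lemma comm_subl (A B : normal_subgroup) : comm A B `<=` A.
Proof.
apply: smallest_sub; first exact: subgroupP.
move=> _ [a Aa [b _ <-]]; rewrite commgEl.
by apply: subgroupM; [exact: subgroupV|exact: normalP].
Qed.

Lemma commS (A B C D : normal_subgroup) :
  A `<=` B -> C `<=` D -> comm A C `<=` comm B D.
Proof.
move=> AB CD; apply: smallest_sub; first exact: generated_is_subgroup.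
move=> _ [a Aa [c Cc <-]]; apply: sub_gen_smallest.
by exists a; [exact: AB|exists c => //; exact: CD].
Qed.

Lemma iter_comm_sub (R : normal_subgroup) c :
  iter_comm R c `<=` meet R (lower_central c.+1).
Proof.
elim: c => [|c IHc] // x Hx; split.
  by have [] := IHc _ (comm_subl Hx).
by apply: (@commS (iter_comm R c)) Hx => // y /IHc [].
Qed.

End Subgroups.

Arguments whole {G}.

Definition perfect_group (G : groupType) : Prop :=
  comm whole whole = [set: G] :> set G.

Definition subgroup_type (G : groupType) (A : subgroup G) : Type := set_type A.

Section SubgroupType.
Variables (G : groupType) (A : subgroup G).

Lemma subgroup_closed : group_closed (mem (subgroup_set A)).
Proof.
split=> [|x y]; rewrite ?inE; first exact: subgroup1.
exact: subgroupF.
Qed.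

HB.instance Definition _ := SubChoice.on (subgroup_type A).
HB.instance Definition _ :=
  SubChoice_isSubGroup.Build G _ (subgroup_type A) subgroup_closed.

End SubgroupType.

Section Quotient.
Variables (G : groupType) (N : normal_subgroup G).

Definition quotient_rel (x y : G) : bool := `[< N (x^-1 * y) >].

Lemma quotient_rel_refl : reflexive quotient_rel.
Proof. by move=> x; apply/asboolP; rewrite mulVg; exact: subgroup1. Qed.

Lemma quotient_rel_sym : symmetric quotient_rel.
Proof.
by move=> x y; apply/asboolP/asboolP => /subgroupV; rewrite invgM invgK.
Qed.

Lemma quotient_rel_trans : transitive quotient_rel.
Proof.
move=> y x z /asboolP xy /asboolP yz; apply/asboolP.
by have := subgroupM xy yz; rewrite mulgA mulgK.
Qed.

Canonical quotient_equiv :=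
  EquivRel quotient_rel quotient_rel_refl quotient_rel_sym quotient_rel_trans.

Definition quotient : Type := {eq_quot quotient_equiv}.
HB.instance Definition _ := EqQuotient.on quotient.
HB.instance Definition _ := Choice.on quotient.

Lemma quotientP (x y : G) :
  (\pi_quotient x = \pi_quotient y) <-> N (x^-1 * y).
Proof.
split=> [/eqP|]; first by rewrite piE => /asboolP.
by move=> Nxy; apply/eqP; rewrite piE; apply/asboolP.
Qed.

Definition quotient_one : quotient := \pi_quotient 1.
Definition quotient_mul (x y : quotient) : quotient :=
  \pi_quotient (repr x * repr y).
Definition quotient_inv (x : quotient) : quotient := \pi_quotient (repr x)^-1.

Lemma repr_rel (x : G) : N (x^-1 * repr (\pi_quotient x)).
Proof. by apply/quotientP; rewrite reprK. Qed.

Lemma pi_quotientM (x y : G) :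
  \pi_quotient (x * y) = quotient_mul (\pi_quotient x) (\pi_quotient y).
Proof.
apply/quotientP.
set x' := repr _; set y' := repr _.
rewrite (_ : _ * _ = (x^-1 * x') ^ y * (y^-1 * y')); last first.
  by rewrite conjgE invgM !mulgA mulgK.
by apply: subgroupM; [apply: normalP|]; exact: repr_rel.
Qed.

Lemma pi_quotientV (x : G) :
  \pi_quotient x^-1 = quotient_inv (\pi_quotient x).
Proof.
apply/quotientP; set x' := repr _.
rewrite (_ : _ * _ = ((x^-1 * x')^-1) ^ x^-1); last first.
  by rewrite conjgE !invgM !invgK !mulgA mulgK.
by apply: normalP; apply: subgroupV; exact: repr_rel.
Qed.

Lemma quotient_mulA : associative quotient_mul.
Proof.
move=> x y z; rewrite -[x]reprK -[y]reprK -[z]reprK.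
move: (repr x) (repr y) (repr z) => {}x {}y {}z.
by rewrite -(pi_quotientM y z) -(pi_quotientM x y) -!pi_quotientM mulgA.
Qed.

Lemma quotient_1mul : left_id quotient_one quotient_mul.
Proof. by move=> x; rewrite -[x]reprK -pi_quotientM mul1g. Qed.

Lemma quotient_mul1 : right_id quotient_one quotient_mul.
Proof. by move=> x; rewrite -[x]reprK -pi_quotientM mulg1. Qed.

Lemma quotient_mulV : left_inverse quotient_one quotient_inv quotient_mul.
Proof. by move=> x; rewrite -[x]reprK -pi_quotientV -pi_quotientM mulVg. Qed.

Lemma quotient_Vmul : right_inverse quotient_one quotient_inv quotient_mul.
Proof. by move=> x; rewrite -[x]reprK -pi_quotientV -pi_quotientM mulgV. Qed.

HB.instance Definition _ := isGroup.Build quotient quotient_mulA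
  quotient_1mul quotient_mul1 quotient_mulV quotient_Vmul.

End Quotient.

(* A / B for normal subgroups B <= A of G: the quotient of the group A by
   the preimage of B under the inclusion of A. *)

Section Subquotient.
Variables (G : groupType) (A B : normal_subgroup G).

Let inner : set (subgroup_type A) := val @^-1` B.

Lemma inner_is_subgroup : is_subgroup inner.
Proof.
split=> [|x y]; rewrite /inner /= ?gmulf1 ?gmulfF; first exact: subgroup1.
exact: subgroupF.
Qed.

Lemma inner_normal x y : inner x -> inner (x ^ y).
Proof.
move=> Bx; rewrite -[inner _]/(B (val (x ^ y))) gmulfJ; exact: normalP.
Qed.

Definition inner_subgroup : normal_subgroup (subgroup_type A) :=
  @NormalSubgroup _ (Subgroup inner_is_subgroup) inner_normal.

Definition subquotient : groupType := quotient inner_subgroup.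

End Subquotient.

Definition abelianization (G : groupType) : groupType :=
  quotient (@comm G whole whole).

Definition free_on (F : groupType) (X : Type) (i : X -> F) : Prop :=
  forall (K : groupType) (f : X -> K),
    (exists phi : group_hom F K, forall x, phi (i x) = f x) /\
    (forall phi psi : group_hom F K,
       (forall x, phi (i x) = f x) -> (forall x, psi (i x) = f x) ->
       phi =1 psi).

Definition free_group (F : groupType) : Prop :=
  exists (X : Type) (i : X -> F), free_on i.

Record free_presentation (G : groupType) := FreePresentation {
  pres_group : groupType;
  pres_rel : normal_subgroup pres_group;
  pres_free : free_group pres_group;
  pres_iso : isomorphic G (quotient pres_rel) }.

(* M^(c)(G), computed from the free presentation P of G. *)
Definition nilpotent_multiplier (c : nat) (G : groupType)
    (P : free_presentation G) : groupType :=
  subquotient (meet (pres_rel P) (lower_central (pres_group P) c.+1))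
              (iter_comm (pres_rel P) c).

Definition schur_multiplier (G : groupType) (P : free_presentation G) :
  groupType := nilpotent_multiplier 1 P.

(* The free product of G and H: words over the disjoint union of G and H,
   modulo the least monoid congruence that makes both inclusions
   multiplicative and unital. *)

Section FreeProduct.
Variables G H : groupType.

Notation word := (seq (G + H)).

Inductive word_eq : word -> word -> Prop :=
| word_refl u : word_eq u u
| word_sym u v : word_eq u v -> word_eq v u
| word_trans u v w : word_eq u v -> word_eq v w -> word_eq u w
| word_cat u u' v v' :
    word_eq u u' -> word_eq v v' -> word_eq (u ++ v) (u' ++ v')
| word_inl1 : word_eq [:: inl 1] [::]
| word_inlM x y : word_eq [:: inl x; inl y] [:: inl (x * y)]
| word_inr1 : word_eq [:: inr 1] [::]
| word_inrM x y : word_eq [:: inr x; inr y] [:: inr (x * y)].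

Definition free_product_rel (u v : word) : bool := `[< word_eq u v >].

Lemma free_product_rel_refl : reflexive free_product_rel.
Proof. by move=> u; apply/asboolP; exact: word_refl. Qed.

Lemma free_product_rel_sym : symmetric free_product_rel.
Proof. by move=> u v; apply/asboolP/asboolP; exact: word_sym. Qed.

Lemma free_product_rel_trans : transitive free_product_rel.
Proof.
move=> v u w /asboolP uv /asboolP vw; apply/asboolP.
exact: word_trans uv vw.
Qed.

Canonical free_product_equiv := EquivRel free_product_rel
  free_product_rel_refl free_product_rel_sym free_product_rel_trans.

Definition free_product : Type := {eq_quot free_product_equiv}.
HB.instance Definition _ := EqQuotient.on free_product.
HB.instance Definition _ := Choice.on free_product.

Lemma free_productP (u v : word) :
  (\pi_free_product u = \pi_free_product v) <-> word_eq u v.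
Proof.
split=> [/eqP|]; first by rewrite piE => /asboolP.
by move=> uv; apply/eqP; rewrite piE; apply/asboolP.
Qed.

Definition letter_inv (s : G + H) : G + H :=
  match s with inl x => inl x^-1 | inr y => inr y^-1 end.

Definition word_inv (u : word) : word := rev (map letter_inv u).

Lemma word_inv_eq u v : word_eq u v -> word_eq (word_inv u) (word_inv v).
Proof.
elim=> {u v} [u|u v _|u v w _ uv _ vw|u u' v v' _ uu' _ vv'| |x y| |x y].
- exact: word_refl.
- exact: word_sym.
- exact: word_trans uv vw.
- by rewrite /word_inv !map_cat !rev_cat; exact: word_cat.
- by rewrite /word_inv /= invg1; exact: word_inl1.
- by rewrite /word_inv /= invgM; exact: word_inlM.
- by rewrite /word_inv /= invg1; exact: word_inr1.
- by rewrite /word_inv /= invgM; exact: word_inrM.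
Qed.

Lemma word_invK : involutive word_inv.
Proof.
move=> u; rewrite /word_inv map_rev revK -map_comp map_id_in // => -[] x _ /=;
  by rewrite invgK.
Qed.

Lemma word_Vmul u : word_eq (u ++ word_inv u) [::].
Proof.
elim/last_ind: u => [|u s IHu]; first exact: word_refl.
rewrite /word_inv map_rcons rev_rcons -/(word_inv u) -cats1 -catA.
apply: word_trans IHu; apply: word_cat; first exact: word_refl.
rewrite -[X in word_eq _ X]cat0s -[letter_inv s :: _]cat1s catA.
apply: word_cat; last exact: word_refl.
by case: s => x /=; [apply: word_trans (word_inlM _ _) _
                    |apply: word_trans (word_inrM _ _) _];
  rewrite mulgV; [exact: word_inl1|exact: word_inr1].
Qed.

Lemma word_mulV u : word_eq (word_inv u ++ u) [::].
Proof. by rewrite -{2}(word_invK u); exact: word_Vmul. Qed.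

Definition free_product_one : free_product := \pi_free_product [::].
Definition free_product_mul (x y : free_product) : free_product :=
  \pi_free_product (repr x ++ repr y).
Definition free_product_inv (x : free_product) : free_product :=
  \pi_free_product (word_inv (repr x)).

Lemma word_repr u : word_eq u (repr (\pi_free_product u)).
Proof. by apply/free_productP; rewrite reprK. Qed.

Lemma pi_free_productM u v :
  \pi_free_product (u ++ v) =
  free_product_mul (\pi_free_product u) (\pi_free_product v).
Proof. by apply/free_productP; apply: word_cat; exact: word_repr. Qed.

Lemma pi_free_productV u :
  \pi_free_product (word_inv u) = free_product_inv (\pi_free_product u).
Proof. by apply/free_productP; apply: word_inv_eq; exact: word_repr. Qed.

Lemma free_product_mulA : associative free_product_mul.
Proof.
move=> x y z; rewrite -[x]reprK -[y]reprK -[z]reprK.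
move: (repr x) (repr y) (repr z) => {}x {}y {}z.
by rewrite -(pi_free_productM y z) -(pi_free_productM x y)
  -!pi_free_productM catA.
Qed.

Lemma free_product_1mul : left_id free_product_one free_product_mul.
Proof. by move=> x; rewrite -[x]reprK -pi_free_productM. Qed.

Lemma free_product_mul1 : right_id free_product_one free_product_mul.
Proof. by move=> x; rewrite -[x]reprK -pi_free_productM cats0. Qed.

Lemma free_product_mulV :
  left_inverse free_product_one free_product_inv free_product_mul.
Proof.
move=> x; rewrite -[x]reprK -pi_free_productV -pi_free_productM.
by apply/free_productP; exact: word_mulV.
Qed.

Lemma free_product_Vmul :
  right_inverse free_product_one free_product_inv free_product_mul.
Proof.
move=> x; rewrite -[x]reprK -pi_free_productV -pi_free_productM.
by apply/free_productP; exact: word_Vmul.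
Qed.

HB.instance Definition _ := isGroup.Build free_product free_product_mulA
  free_product_1mul free_product_mul1 free_product_mulV free_product_Vmul.

Definition free_product_inl (x : G) : free_product :=
  \pi_free_product [:: inl x].
Definition free_product_inr (y : H) : free_product :=
  \pi_free_product [:: inr y].

Lemma free_product_inl1 : free_product_inl 1 = 1.
Proof. by apply/free_productP; exact: word_inl1. Qed.

Lemma free_product_inlM x y :
  free_product_inl (x * y) = free_product_inl x * free_product_inl y.
Proof.
rewrite [RHS](esym (pi_free_productM [:: inl x] [:: inl y])).
by apply/esym/free_productP; exact: word_inlM.
Qed.

Lemma free_product_inr1 : free_product_inr 1 = 1.
Proof. by apply/free_productP; exact: word_inr1. Qed.

Lemma free_product_inrM x y :
  free_product_inr (x * y) = free_product_inr x * free_product_inr y.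
Proof.
rewrite [RHS](esym (pi_free_productM [:: inr x] [:: inr y])).
by apply/esym/free_productP; exact: word_inrM.
Qed.

HB.instance Definition _ := isUMagmaMorphism.Build G free_product
  free_product_inl (free_product_inl1, free_product_inlM).
HB.instance Definition _ := isUMagmaMorphism.Build H free_product
  free_product_inr (free_product_inr1, free_product_inrM).

End FreeProduct.

Lemma free_product_universal (G H K : groupType)
    (f : group_hom G K) (g : group_hom H K) :
  (exists phi : group_hom (free_product G H) K,
     (forall x, phi (free_product_inl H x) = f x) /\
     (forall y, phi (free_product_inr G y) = g y)) /\
  (forall phi psi : group_hom (free_product G H) K,
     (forall x, phi (free_product_inl H x) = psi (free_product_inl H x)) ->
     (forall y, phi (free_product_inr G y) = psi (free_product_inr G y)) ->
     phi =1 psi).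
Proof.
split; last first.
  move=> phi psi eql eqr x; rewrite -[x]reprK.
  elim: (repr x) => [|s u IHu].
    by change (phi 1 = psi 1); rewrite !gmulf1.
  have -> : \pi_(free_product G H) (s :: u) =
      (\pi_(free_product G H) [:: s] : free_product G H) *
      \pi_(free_product G H) u by exact: (pi_free_productM [:: s] u).
  by rewrite !gmulfM IHu; case: s => z; congr (_ * _); [exact: eql|exact: eqr].
pose ev (u : seq (G + H)) : K :=
  \prod_(s <- u) match s with inl x => f x | inr y => g y end.
have ev_eq u v : word_eq u v -> ev u = ev v.
  by rewrite /ev; elim=> {u v} //=
    [u v w _ -> _ -> //|u u' v v' _ e _ e'| |x y| |x y];
    rewrite ?big_cat ?big_cons ?big_nil ?mulg1 ?gmulf1 ?gmulfM //= e e'.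
pose phi (x : free_product G H) := ev (repr x).
have phiM : {morph phi : x y / x * y}.
  move=> x y; rewrite /phi -[RHS]big_cat.
  by apply: ev_eq; apply: word_sym; exact: word_repr.
have phi1 : phi 1 = 1.
  by rewrite /phi -(ev_eq _ _ (word_repr _)) /ev big_nil.
pose mphi := isUMagmaMorphism.Build (free_product G H) K phi (phi1, phiM).
pose Phi : group_hom (free_product G H) K :=
  HB.pack phi mphi.
exists Phi; split=> z; rewrite /= /phi.
- by rewrite -(ev_eq _ _ (word_repr _)) /ev big_seq1.
- by rewrite -(ev_eq _ _ (word_repr _)) /ev big_seq1.
Qed.

(* Main.v *)
Require Import Defs.
From HB Require Import structures.
From mathcomp Require Import all_boot.
From mathcomp Require Import finmap.
From mathcomp Require Import boolp classical_sets cardinality.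
From mathcomp Require Import ssralg ssrint.
Set Implicit Arguments.
Unset Strict Implicit.
Unset Printing Implicit Defensive.
Import GRing.Theory Algebra.

(** Write G and H as quotients of free groups K and L, let F be the free
    product of K and L, S the kernel of the map from F to the free product of
    G and H, and D the kernel of the map from F to K x L (the cartesian
    subgroup).  Put S_k = [S, _k F] and D_k = [D, _k F].

    Two homomorphisms that agree modulo relations induce the same map on
    nilpotent multipliers ([congruent_homs_lower_central]).  So multipliers are
    functorial, they may be computed from any presentation, and the product of
    the multipliers of G and H is a retract of the multiplier of the free
    product.  What has to vanish is the complement ([multiplier_retract]): the
    claim is that D, S and the lower central term gamma_(c+1)(F) meet inside
    S_c ([cartesian_multiplier]).  For c = 1 this always holds, since the
    intersection of D and S is normally generated by the commutators of
    relations with elements of the other factor ([cartesian_kernel]).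

    For larger c, argue by induction.  Coprimality of the abelianizations gives
    that D is contained in S_1 V, where V = D_(c-1) ([cartesian_split]).
    Modulo S_c the groups S and V commute, so the free product of G and H acts
    on V, and each commutator [g, h] has a lift to V, unique up to T, the
    intersection of S and V, which is central by induction.  The failure of a
    choice of lifts to be multiplicative in g and in h is a T-valued cocycle
    that represents a class of the part of H^3(G x H; T) built from both
    factors.  By a Kunneth argument this part is killed by coprime integers,
    and so it is zero ([kunneth_coboundary], [crossed_pairing_lift]): the lifts
    may be chosen as a crossed pairing beta.

    Then (x, y) |-> [x, y] beta(x, y)^-1 is a crossed pairing with values in
    S_1 modulo S_c.  Since F is a free product, it extends to an equivariant
    homomorphism Phi from D to S_1 / S_c ([crossed_pairing_extension]).  On the
    intersection of D and S, Phi is the quotient map, because it is so on the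
    generators.  By equivariance Phi maps D_(c-1) into S_c, so kills it, and
    D_(c-1) is the intersection of D with gamma_(c+1)(F)
    ([cartesian_lower_central]).  Hence an element of all three subgroups is
    trivial modulo S_c.

    The four cases enter only through integers a and b that kill the
    abelianizations of G and H, and integers nG and nH that kill H^2(G; T) and
    H^2(H; T) for every trivial module T, such that a is prime to b and to nH
    and b is prime to nG.  In the first two cases nG is the order of G, by
    averaging ([finite_kills_H2]).  In the third, nG is the order of the Schur
    multiplier times a, by universal coefficients
    ([presentation_kills_H2]).  In the last, a = b = 1 and nG = nH = 0. *)

(** * Commutator calculus modulo normal subgroups *)

Section Commutators.
Local Open Scope classical_set_scope.
Local Open Scope group_scope.

Definition hom_of (G K : groupType) (f : G -> K) (fM : monoid.monoid_morphism f) :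
  group_hom G K := HB.pack f (isUMagmaMorphism.Build G K f fM).

Section OneGroup.
Variable G : groupType.
Implicit Types (A B C N R : normal_subgroup G).

Lemma commg_mulgR (x y z : G) : [~ x, y * z] = [~ x, z] * [~ x, y] ^ z.
Proof. by rewrite /commg /conjg !gnorm. Qed.

Lemma commg_mulgL (x y z : G) : [~ x * y, z] = [~ x, z] ^ y * [~ y, z].
Proof. by rewrite /commg /conjg !gnorm. Qed.

Lemma commute_commg1 (x y : G) : commute x y -> [~ x, y] = 1.
Proof. by move=> /commgP/eqP. Qed.

Lemma commute_conjg (x y : G) : commute x y -> x ^ y = x.
Proof. by move=> xy; rewrite conjgE xy mulKg. Qed.

Lemma commg_mul_central (u r v s : G) :
  commute r u -> commute r v -> commute r s -> commute s u ->
  commute s [~ u, v] -> [~ u * r, v * s] = [~ u, v].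
Proof.
move=> ru rv rs su suv.
rewrite commg_mulgL (@commute_commg1 r) ?mulg1; last exact: commuteM.
rewrite commg_mulgR (@commute_commg1 u) ?mul1g; last exact: commute_sym.
rewrite (@commute_conjg [~ u, v] s); last exact: commute_sym.
apply: commute_conjg; apply: commute_sym.
by rewrite /commg /conjg; do ?apply: commuteM => //; exact: commuteV.
Qed.

Lemma Hall_Witt (x y z : G) :
  [~ [~ x, y^-1], z] ^ y * [~ [~ y, z^-1], x] ^ z * [~ [~ z, x^-1], y] ^ x = 1.
Proof. by rewrite /commg /conjg !gnorm. Qed.

Lemma normalR N x y : N x -> N [~ x, y].
Proof.
move=> Nx; rewrite commgEl.
by apply: subgroupM; [exact: subgroupV|exact: normalP].
Qed.

Lemma quotient_pi_morph N :
  monoid.monoid_morphism (fun x => \pi_(quotient N)%qT x : quotient N).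
Proof. by split=> // x y; rewrite pi_quotientM. Qed.

Definition quotient_hom N : group_hom G (quotient N) :=
  hom_of (quotient_pi_morph N).

Lemma quotient_hom_eq N x y :
  quotient_hom N x = quotient_hom N y <-> N (x^-1 * y).
Proof. exact: quotientP. Qed.

Lemma quotient_hom_eq1 N x : quotient_hom N x = 1 <-> N x.
Proof.
rewrite -[1](@gmulf1 _ _ (quotient_hom N)); split=> [/esym|] h.
  by move/quotient_hom_eq: h; rewrite invg1 mul1g.
by apply/esym/quotient_hom_eq; rewrite invg1 mul1g.
Qed.

Lemma quotient_hom_surj N (z : quotient N) : exists x, quotient_hom N x = z.
Proof. by exists (repr z); rewrite /= reprK. Qed.

Lemma quotient_hom_commute N x y :
  commute (quotient_hom N x) (quotient_hom N y) <-> N [~ x, y].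
Proof.
rewrite -quotient_hom_eq1 gmulfR.
by split=> [/commgP/eqP|/eqP/commgP].
Qed.

Lemma comm_min A B (N : set G) : is_subgroup N ->
  (forall a b, A a -> B b -> N [~ a, b]) -> comm A B `<=` N.
Proof.
by move=> sN h; apply: smallest_sub => // _ [a Aa [b Bb <-]]; exact: h.
Qed.

Lemma comm_gen A B a b : A a -> B b -> comm A B [~ a, b].
Proof. by move=> Aa Bb; apply: sub_gen_smallest; exists a => //; exists b. Qed.

Lemma commC A B : comm A B `<=` comm B A.
Proof.
apply: comm_min; first exact: subgroupP.
by move=> a b Aa Bb; rewrite -invgR; apply: subgroupV; exact: comm_gen.
Qed.

Lemma centralizer_mod_subgroup (C : set G) N :
  is_subgroup [set u | forall c, C c -> N [~ u, c]].
Proof.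
split=> [c _|x y hx hy c Cc]; first by rewrite comm1g; exact: subgroup1.
apply/quotient_hom_commute; rewrite gmulfF.
apply: commute_sym; apply: commuteM; last apply: commuteV.
  by apply/commute_sym/quotient_hom_commute; exact: hx.
by apply/commute_sym/quotient_hom_commute; exact: hy.
Qed.

(** The elementwise form of the three subgroups lemma, for entries that range
    over subgroups that are not normal, such as the factors of a free
    product. *)
Lemma Hall_Witt_mem N a b c :
  N [~ [~ b^-1, c^-1], a] -> N [~ [~ c, a^-1], b^-1] -> N [~ [~ a, b], c].
Proof.
move=> hBCA hCAB; have := Hall_Witt a b^-1 c; rewrite invgK.
set X := [~ [~ a, b], c]; set Y := _ ^ c; set Z := _ ^ a => e.
have {e} -> : X = ((Y * Z)^-1) ^ b.
  move/eqP: e; rewrite -mulgA mulg_eq1 => /eqP <-.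
  by rewrite -conjgM mulVg conjg1.
by apply: normalP; apply: subgroupV; apply: subgroupM; exact: normalP.
Qed.

Lemma three_subgroups A B C N :
  comm (comm B C) A `<=` N -> comm (comm C A) B `<=` N ->
  comm (comm A B) C `<=` N.
Proof.
move=> hBCA hCAB; apply: comm_min; first exact: subgroupP.
move=> u c + Cc; move: u.
suff: comm A B `<=` [set u | forall c, C c -> N [~ u, c]].
  by move=> h u /h; apply.
apply: comm_min; first exact: centralizer_mod_subgroup.
move=> a b Aa Bb {Cc}c Cc; apply: Hall_Witt_mem.
  by apply: hBCA; apply: comm_gen => //; apply: comm_gen; exact: subgroupV.
by apply: hCAB; apply: comm_gen; try apply: comm_gen => //; exact: subgroupV.
Qed.

Lemma iter_commSr R c :
  iter_comm R c.+1 = iter_comm (comm R whole) c.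
Proof. by rewrite /iter_comm iterSr. Qed.

Lemma iter_commD R c d : iter_comm (iter_comm R c) d = iter_comm R (d + c).
Proof. by rewrite /iter_comm iterD. Qed.

Lemma iter_comm_subl R c : iter_comm R c `<=` R.
Proof.
by elim: c => [|c IHc] // x hx; apply: IHc; exact: (@comm_subl _ _ whole).
Qed.

Lemma iter_comm_le R c d : c <= d -> iter_comm R d `<=` iter_comm R c.
Proof.
by move=> /subnK <-; rewrite -iter_commD; exact: iter_comm_subl.
Qed.

Lemma lower_central_le c d : c <= d -> lower_central G d `<=` lower_central G c.
Proof. by move=> cd; apply: iter_comm_le; rewrite -!subn1 leq_sub2r. Qed.

(** The three subgroups lemma trades one commutator with gamma_(k+1) for two
    nested commutators with gamma_k and G; the statement must be general in R
    because the induction applies it to [R, G]. *)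
Lemma comm_lower_central R k :
  comm R (lower_central G k.+1) `<=` iter_comm R k.+1.
Proof.
elim: k R => [|k IHk] R //.
apply: subset_trans (@commC _ _) _.
apply: three_subgroups.
  apply: subset_trans (commS (@commC _ _) (@subset_refl _ _)) _.
  by rewrite iter_commSr; exact: IHk.
by apply: commS => //; exact: IHk.
Qed.

Lemma lower_central_comm R k x y :
  R x -> lower_central G k.+1 y -> iter_comm R k.+1 [~ x, y].
Proof. by move=> Rx ky; apply: comm_lower_central; exact: comm_gen. Qed.

End OneGroup.

Section Homs.
Variables G K : groupType.

Lemma preimage_subgroup (f : group_hom G K) (N : subgroup K) :
  is_subgroup [set x | N (f x)].
Proof.
split=> [|x y] /=; first by rewrite gmulf1; exact: subgroup1.
by rewrite gmulfF; exact: subgroupF.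
Qed.

Lemma hom_comm (f : group_hom G K) (A B : normal_subgroup G)
    (A' B' : normal_subgroup K) :
  (forall x, A x -> A' (f x)) -> (forall x, B x -> B' (f x)) ->
  forall x, comm A B x -> comm A' B' (f x).
Proof.
move=> hA hB; apply: (@comm_min _ _ _ [set x | comm A' B' (f x)]).
  exact: preimage_subgroup.
move=> a b Aa Bb; change (comm A' B' (f [~ a, b])); rewrite gmulfR.
by apply: comm_gen; [exact: hA|exact: hB].
Qed.

Lemma hom_iter_comm (f : group_hom G K) (R : normal_subgroup G)
    (R' : normal_subgroup K) c :
  (forall x, R x -> R' (f x)) ->
  forall x, iter_comm R c x -> iter_comm R' c (f x).
Proof. by move=> hR; elim: c => [|c IHc] //; exact: hom_comm. Qed.

Lemma hom_lower_central (f : group_hom G K) c x :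
  lower_central G c x -> lower_central K c (f x).
Proof. exact: hom_iter_comm. Qed.

Lemma eq_hom_subgroup (f g : group_hom G K) : is_subgroup [set x | f x = g x].
Proof.
split=> [|x y /= ex ey]; first by rewrite /= !gmulf1.
by rewrite !gmulfF ex ey.
Qed.
End Homs.

(** Changing one entry of a (k+1)-fold commutator by an element of R changes its
    value by an element of [R, _k K].  This makes multipliers independent of
    the choice of lifts. *)
Lemma congruent_homs_lower_central (G K : groupType) (f g : group_hom G K)
    (R : normal_subgroup K) :
  (forall x, R ((f x)^-1 * g x)) ->
  forall k x, lower_central G k.+1 x -> iter_comm R k ((f x)^-1 * g x).
Proof.
move=> fg; elim=> [|k IHk] x; first by move=> _; exact: fg.
pose q := quotient_hom (iter_comm R k.+1).
move=> hx; apply/quotient_hom_eq; rewrite -/q; move: x hx.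
apply: (@comm_min _ _ _ [set x | q (f x) = q (g x)]).
  exact: (@eq_hom_subgroup _ _ (q \o f) (q \o g)).
move=> u v hu _; change (q (f [~ u, v]) = q (g [~ u, v])); rewrite !gmulfR.
have -> : q (g u) = q (f u) * q ((f u)^-1 * g u) by rewrite -gmulfM mulVKg.
have -> : q (g v) = q (f v) * q ((f v)^-1 * g v) by rewrite -gmulfM mulVKg.
have hr z : commute (q ((f u)^-1 * g u)) (q z).
  by apply/quotient_hom_commute; apply: comm_gen => //; exact: IHk.
have hs z : lower_central K k.+1 z -> commute (q ((f v)^-1 * g v)) (q z).
  by move=> hz; apply/quotient_hom_commute; exact: lower_central_comm.
apply/esym/commg_mul_central => //.
  by apply: hs; exact: hom_lower_central.
by rewrite -gmulfR; apply/hs/normalR; exact: hom_lower_central.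
Qed.

End Commutators.

(** * Free presentations and free products *)

Section Presentations.
Local Open Scope classical_set_scope.
Local Open Scope group_scope.

Lemma trivial_morphism (G K : groupType) : monoid.monoid_morphism (fun _ : G => 1 : K).
Proof. by split=> // x y; rewrite mul1g. Qed.

Definition trivial_hom (G K : groupType) : group_hom G K :=
  hom_of (@trivial_morphism G K).

Section Kernel.
Variables (G K : groupType) (f : group_hom G K).

Lemma kernel_is_subgroup : is_subgroup [set x | f x = 1].
Proof. exact: (@eq_hom_subgroup _ _ f (trivial_hom G K)). Qed.

Lemma kernel_normal x y : [set x | f x = 1] x -> [set x | f x = 1] (x ^ y).
Proof. by move=> /= fx; rewrite gmulfJ fx conj1g. Qed.

Definition kernel : normal_subgroup G :=
  @NormalSubgroup _ (Subgroup kernel_is_subgroup) kernel_normal.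

End Kernel.

(** Replaces the isomorphism of G with a quotient by an epimorphism onto G with
    the right kernel, so that lifts are compared inside G itself. *)
Lemma presentation_epi (G : groupType) (P : free_presentation G) :
  exists p : group_hom (pres_group P) G,
    (forall g, exists x, p x = g) /\ (forall x, p x = 1 <-> pres_rel P x).
Proof.
case: (pres_iso P) => f [f' fK f'K].
pose q := quotient_hom (pres_rel P).
pose h (x : pres_group P) : G := f' (q x).
have hM : monoid.monoid_morphism h.
  split; first by rewrite /h gmulf1; exact: (can2_gmulf1 fK f'K).
  by move=> x y; rewrite /h gmulfM; exact: (can2_gmulfM fK f'K).
exists (hom_of hM); split=> [g|x] /=.
  have [x qx] := quotient_hom_surj (f g).
  by exists x; rewrite /h qx fK.
split=> [hx|/quotient_hom_eq1 qx]; last first.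
  by rewrite /h qx; exact: (can2_gmulf1 fK f'K).
by apply/quotient_hom_eq1; rewrite -/q -[q x]f'K -/(h x) hx gmulf1.
Qed.

Lemma free_lift (F K L : groupType) (q : group_hom K L) (f : group_hom F L) :
  free_group F -> (forall y, exists x, q x = y) ->
  exists phi : group_hom F K, forall x, q (phi x) = f x.
Proof.
move=> [X [i Fi]] q_surj.
have [k qk] := choice (fun x => q_surj (f (i x))).
have [[phi phiE] _] := Fi K k.
have [_ uniq] := Fi L (f \o i).
exists phi; apply: (uniq (q \o phi : group_hom F L) f) => // y.
by rewrite /= phiE qk.
Qed.

Section FreeProductHoms.
Variables G H : groupType.

Definition inl_hom : group_hom G (free_product G H) := @free_product_inl G H.
Definition inr_hom : group_hom H (free_product G H) := @free_product_inr G H.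

Definition copair (K : groupType) (f : group_hom G K) (g : group_hom H K) :
    group_hom (free_product G H) K :=
  sval (cid (proj1 (free_product_universal f g))).

Lemma copair_inl (K : groupType) (f : group_hom G K) (g : group_hom H K) x :
  copair f g (inl_hom x) = f x.
Proof. by rewrite /copair; case: cid => phi /= [hl _]; exact: hl. Qed.

Lemma copair_inr (K : groupType) (f : group_hom G K) (g : group_hom H K) y :
  copair f g (inr_hom y) = g y.
Proof. by rewrite /copair; case: cid => phi /= [_ hr]; exact: hr. Qed.

Lemma eq_hom_free_product (K : groupType)
    (f g : group_hom (free_product G H) K) :
  (forall x, f (inl_hom x) = g (inl_hom x)) ->
  (forall y, f (inr_hom y) = g (inr_hom y)) -> f =1 g.
Proof.
exact: (proj2 (free_product_universal (trivial_hom G K) (trivial_hom H K))).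
Qed.

Lemma free_product_recr (P : free_product G H -> Prop) : P 1 ->
  (forall z x, P z -> P (z * inl_hom x)) ->
  (forall z y, P z -> P (z * inr_hom y)) -> forall z, P z.
Proof.
move=> P1 Pl Pr z; rewrite -[z]reprK.
elim/last_ind: (repr z) => [|u s IHu]; first exact: P1.
have -> : \pi_(free_product G H)%qT (rcons u s) =
    (\pi_(free_product G H)%qT u : free_product G H) *
    \pi_(free_product G H)%qT [:: s].
  by rewrite -cats1; exact: (pi_free_productM u [:: s]).
by case: s => s; [exact: Pl|exact: Pr].
Qed.

Lemma free_product_ind (P : set (free_product G H)) : is_subgroup P ->
  (forall x, P (inl_hom x)) -> (forall y, P (inr_hom y)) -> forall z, P z.
Proof.
move=> sP Pl Pr; pose N := Subgroup sP.
apply: free_product_recr; first exact: (subgroup1 N).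
  by move=> z x Pz; apply: (@subgroupM _ N).
by move=> z y Pz; apply: (@subgroupM _ N).
Qed.

Definition proj_l : group_hom (free_product G H) G :=
  copair idfun (trivial_hom H G).
Definition proj_r : group_hom (free_product G H) H :=
  copair (trivial_hom G H) idfun.

Lemma proj_lE x : proj_l (inl_hom x) = x. Proof. exact: copair_inl. Qed.
Lemma proj_l1 y : proj_l (inr_hom y) = 1. Proof. exact: copair_inr. Qed.
Lemma proj_r1 x : proj_r (inl_hom x) = 1. Proof. exact: copair_inl. Qed.
Lemma proj_rE y : proj_r (inr_hom y) = y. Proof. exact: copair_inr. Qed.

Definition cartesian : normal_subgroup (free_product G H) :=
  meet (kernel proj_l) (kernel proj_r).

End FreeProductHoms.

Section FreeProductMap.
Variables G H K L : groupType.
Variables (f : group_hom K G) (g : group_hom L H).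

Definition free_product_map : group_hom (free_product K L) (free_product G H) :=
  copair (inl_hom G H \o f) (inr_hom G H \o g).

Lemma free_product_mapl x : free_product_map (inl_hom K L x) = inl_hom G H (f x).
Proof. exact: copair_inl. Qed.

Lemma free_product_mapr y : free_product_map (inr_hom K L y) = inr_hom G H (g y).
Proof. exact: copair_inr. Qed.

Lemma proj_l_map z : proj_l G H (free_product_map z) = f (proj_l K L z).
Proof.
apply: (eq_hom_free_product (f := proj_l G H \o free_product_map)
                            (g := f \o proj_l K L)) => x /=.
  by rewrite free_product_mapl !proj_lE.
by rewrite free_product_mapr !proj_l1 gmulf1.
Qed.

Lemma proj_r_map z : proj_r G H (free_product_map z) = g (proj_r K L z).
Proof.
apply: (eq_hom_free_product (f := proj_r G H \o free_product_map)
                            (g := g \o proj_r K L)) => x /=.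
  by rewrite free_product_mapl !proj_r1 gmulf1.
by rewrite free_product_mapr !proj_rE.
Qed.

Lemma free_product_map_surj :
  (forall x, exists y, f y = x) -> (forall x, exists y, g y = x) ->
  forall z, exists w, free_product_map w = z.
Proof.
move=> f_surj g_surj.
apply: (@free_product_ind _ _ [set z | exists w, free_product_map w = z]).
- split=> [|x y [u <-] [v <-]]; first by exists 1; rewrite gmulf1.
  by exists (u / v); rewrite gmulfF.
- by move=> x; have [u <-] := f_surj x; exists (inl_hom K L u);
    exact: free_product_mapl.
- by move=> y; have [u <-] := g_surj y; exists (inr_hom K L u);
    exact: free_product_mapr.
Qed.

End FreeProductMap.

Lemma inj_surj_bij (T U : Type) (f : T -> U) :
  injective f -> (forall y, exists x, f x = y) -> bijective f.
Proof.
move=> f_inj /choice[g gK]; exists g => // x.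
by apply: f_inj; rewrite gK.
Qed.

Lemma first_isomorphism (G K : groupType) (N : normal_subgroup G)
    (f : group_hom G K) :
  (forall y, exists x, f x = y) -> (forall x, f x = 1 <-> N x) ->
  isomorphic (quotient N) K.
Proof.
move=> f_surj kerf; pose h (z : quotient N) : K := f (repr z).
have f_eq x y : f x = f y <-> N (x^-1 * y).
  rewrite -kerf gmulfM gmulfV; split=> [->|]; first by rewrite mulVg.
  by move/mulg1_eq; rewrite invgK.
have hE x : h (quotient_hom N x) = f x.
  by apply/f_eq/quotient_hom_eq; rewrite /= reprK.
have hM : monoid.monoid_morphism h.
  split; first by rewrite -[1](@gmulf1 _ _ (quotient_hom N)) hE gmulf1.
  move=> y z; have [[u <-] [v <-]] := (quotient_hom_surj y, quotient_hom_surj z).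
  by rewrite -gmulfM !hE gmulfM.
exists (hom_of hM); apply: inj_surj_bij.
  move=> y z /=; have [[u <-] [v <-]] := (quotient_hom_surj y, quotient_hom_surj z).
  by rewrite !hE => /f_eq/quotient_hom_eq.
by move=> y; have [x <-] := f_surj y; exists (quotient_hom N x); rewrite /= hE.
Qed.

(** * Functoriality of nilpotent multipliers *)

Section Subquotients.

Definition subgroup_elt (G : groupType) (A : subgroup G) x (Ax : A x) :
  subgroup_type A := SigSub (mem_set Ax).

Lemma subgroup_eltP (G : groupType) (A : subgroup G)
  (u : subgroup_type A) : A (val u).
Proof. exact: set_valP. Qed.

Lemma subquotient_eq (G : groupType) (A B : normal_subgroup G)
    (u v : subgroup_type A) :
  quotient_hom (inner_subgroup A B) u = quotient_hom (inner_subgroup A B) v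
  <-> B ((val u)^-1 * val v).
Proof.
rewrite quotient_hom_eq -[inner_subgroup A B _]/(B (val (u^-1 * v))).
by rewrite gmulfM gmulfV.
Qed.

Definition restricted_class (G K : groupType) (A : normal_subgroup G)
    (A' B' : normal_subgroup K) (f : group_hom G K)
    (hA : forall x, A x -> A' (f x)) (u : subgroup_type A) :
    subquotient A' B' :=
  quotient_hom (inner_subgroup A' B') (subgroup_elt (hA _ (subgroup_eltP u))).

Lemma restricted_class_morphism (G K : groupType) (A : normal_subgroup G)
    (A' B' : normal_subgroup K) (f : group_hom G K)
    (hA : forall x, A x -> A' (f x)) :
  monoid.monoid_morphism (restricted_class B' hA).
Proof.
split=> [|u v]; rewrite /restricted_class.
  rewrite -[RHS](@gmulf1 _ _ (quotient_hom (inner_subgroup A' B'))).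
  by congr (quotient_hom _ _); apply: val_inj; rewrite /= !gmulf1.
rewrite -gmulfM; congr (quotient_hom _ _); apply: val_inj.
by rewrite [RHS]gmulfM; change (f (val (u * v)) = f (val u) * f (val v));
  rewrite !gmulfM.
Qed.

(** The form in which the direct sum decomposition is checked: on elements of
    the ambient groups, without mention of cosets. *)
Lemma subquotient_iso_prod (G G1 G2 : groupType) (A B : normal_subgroup G)
    (A1 B1 : normal_subgroup G1) (A2 B2 : normal_subgroup G2)
    (f1 : group_hom G G1) (f2 : group_hom G G2) :
  (forall x, A x -> A1 (f1 x)) -> (forall x, A x -> A2 (f2 x)) ->
  (forall x, A x -> B x <-> B1 (f1 x) /\ B2 (f2 x)) ->
  (forall x1 x2, A1 x1 -> A2 x2 ->
     exists2 x, A x & B1 (x1^-1 * f1 x) /\ B2 (x2^-1 * f2 x)) ->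
  isomorphic (subquotient A B) (subquotient A1 B1 * subquotient A2 B2)%type.
Proof.
move=> hA1 hA2 hB onto.
pose f u := (restricted_class B1 hA1 u, restricted_class B2 hA2 u).
have fM : monoid.monoid_morphism f.
  have [[e1 m1] [e2 m2]] := (restricted_class_morphism B1 hA1,
                             restricted_class_morphism B2 hA2).
  by split=> [|u v]; rewrite /f ?e1 ?e2 ?m1 ?m2.
apply: (@first_isomorphism _ _ _ (hom_of fM)) => [[y1 y2]|u] /=.
  have [[u1 <-] [u2 <-]] := (quotient_hom_surj y1, quotient_hom_surj y2).
  have [x Ax [Bx1 Bx2]] := onto _ _ (subgroup_eltP u1) (subgroup_eltP u2).
  exists (subgroup_elt Ax); rewrite /f /restricted_class.
  by congr (_, _); apply/esym/subquotient_eq.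
rewrite -[X in _ <-> X]/(B (val u)) hB; last exact: subgroup_eltP.
split=> [[/quotient_hom_eq1 ? /quotient_hom_eq1] //|[? ?]].
by congr (_, _); apply/quotient_hom_eq1.
Qed.

End Subquotients.

Section NilpotentMultiplier.

Lemma congruent_lifts (F K L : groupType) (f g : group_hom F K)
    (p : group_hom K L) (R : normal_subgroup K) c x :
  (forall z, p (f z) = p (g z)) -> (forall z, p z = 1 <-> R z) ->
  lower_central F c.+1 x -> iter_comm R c (f x) -> iter_comm R c (g x).
Proof.
move=> fg kerp hx Rfx.
rewrite -(mulVKg (f x) (g x)); apply: subgroupM => //.
apply: congruent_homs_lower_central => // z.
by apply/kerp; rewrite gmulfM gmulfV fg mulVg.
Qed.

(** The inclusions and projections of the free product lift to the presentation
    groups, and their composites are congruent to the identity or to the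
    trivial map.  This gives surjectivity.  For injectivity, an element is
    moved to the free product of the presentation groups and divided by its
    two projections, which leaves an element of the cartesian subgroup. *)
Lemma multiplier_retract (G H : groupType)
    (PG : free_presentation G) (PH : free_presentation H)
    (PGH : free_presentation (free_product G H))
    (p1 : group_hom (pres_group PG) G) (p2 : group_hom (pres_group PH) H)
    (c : nat) :
  (forall g, exists x, p1 x = g) -> (forall h, exists y, p2 y = h) ->
  (forall x, p1 x = 1 <-> pres_rel PG x) ->
  (forall y, p2 y = 1 <-> pres_rel PH y) ->
  (forall w, cartesian _ _ w ->
     kernel (free_product_map p1 p2) w -> lower_central _ c.+1 w ->
     iter_comm (kernel (free_product_map p1 p2)) c w) ->
  isomorphic (nilpotent_multiplier c PGH)
             (nilpotent_multiplier c PG * nilpotent_multiplier c PH)%type.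
Proof.
move=> p1_surj p2_surj kerp1 kerp2 key.
have [p0 [p0_surj kerp0]] := presentation_epi PGH.
set R0 := pres_rel PGH in kerp0; set R1 := pres_rel PG in kerp1.
set R2 := pres_rel PH in kerp2.
set S := kernel _ in key.
have [f1 f1E] := free_lift (proj_l G H \o p0) (pres_free PGH) p1_surj.
have [f2 f2E] := free_lift (proj_r G H \o p0) (pres_free PGH) p2_surj.
have [j1 j1E] := free_lift (inl_hom G H \o p1) (pres_free PG) p0_surj.
have [j2 j2E] := free_lift (inr_hom G H \o p2) (pres_free PH) p0_surj.
have [t tE] := free_lift p0 (pres_free PGH) (free_product_map_surj p1_surj p2_surj).
rewrite /= in f1E f2E j1E j2E tE.
have hf1 x : R0 x -> R1 (f1 x).
  by move=> /kerp0 e; apply/kerp1; rewrite f1E e gmulf1.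
have hf2 x : R0 x -> R2 (f2 x).
  by move=> /kerp0 e; apply/kerp2; rewrite f2E e gmulf1.
have hj1 x : R1 x -> R0 (j1 x).
  by move=> /kerp1 e; apply/kerp0; rewrite j1E e gmulf1.
have hj2 x : R2 x -> R0 (j2 x).
  by move=> /kerp2 e; apply/kerp0; rewrite j2E e gmulf1.
apply: (subquotient_iso_prod (f1 := f1) (f2 := f2)).
- by move=> x [Rx gx]; split; [exact: hf1|exact: hom_lower_central].
- by move=> x [Rx gx]; split; [exact: hf2|exact: hom_lower_central].
- move=> w [Rw gw]; split=> [Bw|[Bw1 Bw2]].
    by split; apply: hom_iter_comm Bw.
  pose e := copair j1 j2.
  have eE z : p0 (e z) = free_product_map p1 p2 z.
    apply: (eq_hom_free_product (f := p0 \o e)) => y /=.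
      by rewrite /e copair_inl j1E free_product_mapl.
    by rewrite /e copair_inr j2E free_product_mapr.
  apply: (@congruent_lifts _ _ _ (e \o t) idfun p0) => //= [z|].
    by rewrite eE tE.
  apply: (@hom_iter_comm _ _ e S).
    by move=> x Sx; apply/kerp0; rewrite eE.
  have S1 : iter_comm R1 c (proj_l _ _ (t w)).
    apply: (@congruent_lifts _ _ _ f1 (proj_l _ _ \o t) p1) => //= z.
    by rewrite f1E -(proj_l_map p1 p2) tE.
  have S2 : iter_comm R2 c (proj_r _ _ (t w)).
    apply: (@congruent_lifts _ _ _ f2 (proj_r _ _ \o t) p2) => //= z.
    by rewrite f2E -(proj_r_map p1 p2) tE.
  set u := inl_hom _ _ (proj_l _ _ (t w)) * inr_hom _ _ (proj_r _ _ (t w)).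
  have Su : iter_comm S c u.
    apply: subgroupM.
      apply: (@hom_iter_comm _ _ (inl_hom _ _) R1) S1 => x /kerp1 px.
      by change (free_product_map p1 p2 (inl_hom _ _ x) = 1);
        rewrite free_product_mapl px gmulf1.
    apply: (@hom_iter_comm _ _ (inr_hom _ _) R2) S2 => x /kerp2 px.
    by change (free_product_map p1 p2 (inr_hom _ _ x) = 1);
      rewrite free_product_mapr px gmulf1.
  have [Su' gu] := iter_comm_sub Su.
  rewrite -(mulVKg u (t w)); apply: subgroupM => //; apply: key.
  + split=> /=.
      by rewrite gmulfM gmulfV gmulfM proj_lE proj_l1 mulg1 mulVg.
    by rewrite gmulfM gmulfV gmulfM proj_rE proj_r1 mul1g mulVg.
  + apply: subgroupM; first exact: subgroupV.
    by change (free_product_map p1 p2 (t w) = 1); rewrite tE; apply/kerp0.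
  + apply: subgroupM; first exact: subgroupV.
    exact: hom_lower_central.
- move=> x1 x2 [Rx1 gx1] [Rx2 gx2]; exists (j1 x1 * j2 x2).
    split; first by apply: subgroupM; [exact: hj1|exact: hj2].
    by apply: subgroupM; exact: hom_lower_central.
  have h11 : iter_comm R1 c (x1^-1 * f1 (j1 x1)).
    apply: (@congruent_homs_lower_central _ _ idfun (f1 \o j1)) => //= z.
    by apply/kerp1; rewrite gmulfM gmulfV f1E j1E proj_lE mulVg.
  have h12 : iter_comm R1 c (f1 (j2 x2)).
    apply: (@congruent_lifts _ _ _ (trivial_hom _ _) (f1 \o j2) p1) => //= [z|].
      by rewrite f1E j2E proj_l1 gmulf1.
    exact: subgroup1.
  have h22 : iter_comm R2 c (x2^-1 * f2 (j2 x2)).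
    apply: (@congruent_homs_lower_central _ _ idfun (f2 \o j2)) => //= z.
    by apply/kerp2; rewrite gmulfM gmulfV f2E j2E proj_rE mulVg.
  have h21 : iter_comm R2 c (f2 (j1 x1)).
    apply: (@congruent_lifts _ _ _ (trivial_hom _ _) (f2 \o j1) p2) => //= [z|].
      by rewrite f2E j1E proj_r1 gmulf1.
    exact: subgroup1.
  rewrite !gmulfM; split; first by rewrite mulgA; exact: subgroupM.
  rewrite [X in iter_comm _ _ X](_ : _ =
    f2 (j1 x1) ^ x2 * (x2^-1 * f2 (j2 x2))); last by rewrite conjgE !gnorm.
  by apply: subgroupM => //; exact: normalP.
Qed.

End NilpotentMultiplier.
End Presentations.

(** * Linear identities in abelian groups *)

Section ZmodIdentities.
Local Open Scope ring_scope.

Inductive zexpr : Type :=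
| ZVar of nat | ZZero | ZAdd of zexpr & zexpr | ZOpp of zexpr.

Fixpoint zcoef (e : zexpr) (i : nat) : int :=
  match e with
  | ZVar j => (j == i)%:Z
  | ZZero => 0
  | ZAdd e1 e2 => zcoef e1 i + zcoef e2 i
  | ZOpp e1 => - zcoef e1 i
  end.

Fixpoint zeval (T : zmodType) (env : seq T) (e : zexpr) : T :=
  match e with
  | ZVar j => nth 0 env j
  | ZZero => 0
  | ZAdd e1 e2 => zeval env e1 + zeval env e2
  | ZOpp e1 => - zeval env e1
  end.

(** An expression is determined by its integer coefficients, so an identity may
    be decided by comparing them. *)
Lemma zeval_coef (T : zmodType) (env : seq T) (e : zexpr) :
  zeval env e = \sum_(0 <= i < size env) nth 0 env i *~ zcoef e i.
Proof.
elim: e => [j||e1 IH1 e2 IH2|e IH] /=; rewrite ?IH1 ?IH2 ?IH ?big_mkord.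
- have [jn|nj] := ltnP j (size env); last first.
    rewrite nth_default // big1 // => i _.
    by rewrite (negPf (_ : j != i)) // neq_ltn (leq_trans (ltn_ord i) nj) orbT.
  rewrite (bigD1 (Ordinal jn)) //= eqxx mulr1z big1 ?addr0 // => i ij.
  by rewrite (negPf (_ : j != i)) // eq_sym.
- by rewrite big1.
- by rewrite -big_split; apply: eq_bigr => i _; rewrite mulrzDr.
- by rewrite -sumrN; apply: eq_bigr => i _; rewrite mulrNz.
Qed.

Lemma zeval_eq (T : zmodType) (env : seq T) (e1 e2 : zexpr) :
  all (fun i => zcoef e1 i == zcoef e2 i) (iota 0 (size env)) ->
  zeval env e1 = zeval env e2.
Proof.
move=> /allP h; rewrite !zeval_coef; apply: eq_big_nat => i /andP[_ i_lt].
by rewrite (eqP (h i _)) // mem_iota.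
Qed.

End ZmodIdentities.

(* Atoms are compared up to unification, since the same group operation occurs
   through different coercion paths. *)
Ltac zindex x env :=
  match env with
  | ?y :: _ => let _ := match constr:(Set) with _ => unify x y end in
               constr:(0%N)
  | _ :: ?env' => let n := zindex x env' in constr:(n.+1)
  end.

Ltac zenv t env :=
  lazymatch t with
  | (?a + ?b)%R => let env1 := zenv a env in zenv b env1
  | (- ?a)%R => zenv a env
  | 0%R => env
  | ?x => match constr:(Set) with
          | _ => let n := zindex x env in env
          | _ => constr:(x :: env)
          end
  end.

Ltac zreify t env :=
  lazymatch t with
  | (?a + ?b)%R =>
      let ea := zreify a env in let eb := zreify b env in constr:(ZAdd ea eb)
  | (- ?a)%R => let ea := zreify a env in constr:(ZOpp ea)
  | 0%R => constr:(ZZero)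
  | ?x => let n := zindex x env in constr:(ZVar n)
  end.
Ltac zmod :=
  match goal with
  | |- ?l = ?r :> ?T =>
    let env1 := zenv l (@nil T) in
    let env := zenv r env1 in
    let el := zreify l env in
    let er := zreify r env in
    apply: (@zeval_eq _ env el er); vm_compute; reflexivity
  end.

(** * Second cohomology with trivial coefficients *)

Section Cohomology.
Local Open Scope ring_scope.

(** Reduces an equation that follows from a linear combination of known ones to
    an identity. *)
Lemma eq_by (T : zmodType) (x y l r : T) : l = r -> x - y = l - r -> x = y.
Proof. by move=> -> /eqP; rewrite subrr subr_eq0 => /eqP. Qed.

Definition cocycle2 (G : groupType) (T : zmodType) (k : G -> G -> T) : Prop :=
  forall x y z, k x y + k (x * y)%g z = k y z + k x (y * z)%g.

Definition cobound (G : groupType) (T : zmodType) (t : G -> T) (x y : G) : T :=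
  t x + t y - t (x * y)%g.

Definition coboundary2 (G : groupType) (T : zmodType) (k : G -> G -> T) : Prop :=
  exists t, forall x y, k x y = cobound t x y.

(** n annihilates H^2(G; T) for every abelian group T with trivial action. *)
Definition kills_H2 (G : groupType) (n : nat) : Prop :=
  forall (T : zmodType) (k : G -> G -> T),
    cocycle2 k -> coboundary2 (fun x y => k x y *+ n).

Definition kills_ab (G : groupType) (n : nat) : Prop :=
  forall x : G, comm (@whole G) whole (x ^+ n)%g.

Section Coboundaries.
Variables (G : groupType) (T : zmodType).
Implicit Types k l : G -> G -> T.

Lemma eq_coboundary2 k l :
  (forall x y, k x y = l x y) -> coboundary2 k -> coboundary2 l.
Proof. by move=> kl [t kt]; exists t => x y; rewrite -kl. Qed.

Lemma coboundary2D k l : coboundary2 k -> coboundary2 l ->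
  coboundary2 (fun x y => k x y + l x y).
Proof.
move=> [t kt] [u lu]; exists (fun x => t x + u x) => x y.
by rewrite kt lu /cobound; zmod.
Qed.

Lemma coboundary2N k : coboundary2 k -> coboundary2 (fun x y => - k x y).
Proof.
move=> [t kt]; exists (fun x => - t x) => x y.
by rewrite kt /cobound; zmod.
Qed.

Lemma coboundary2_cobound (t : G -> T) : coboundary2 (cobound t).
Proof. by exists t. Qed.

Lemma coboundary2Mn k n : coboundary2 k -> coboundary2 (fun x y => k x y *+ n).
Proof.
move=> [t kt]; exists (fun x => t x *+ n) => x y.
by rewrite kt /cobound mulrnBl mulrnDl.
Qed.

End Coboundaries.

Lemma coprime_Bezout m n : coprime m n ->
  (exists q r, q * m = (r * n).+1)%N \/ (exists q r, r * n = (q * m).+1)%N.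
Proof.
case: m => [|m] mn.
  by right; exists 0%N, 1%N; move: mn; rewrite /coprime gcd0n => /eqP ->.
have [r _] := Bezoutl n (ltn0Sn m); rewrite (eqP mn) => /dvdnP[q e].
by left; exists q, r; rewrite -e.
Qed.

Lemma coprime_coboundary2 (G : groupType) (T : zmodType) (k : G -> G -> T) m n :
  coprime m n -> coboundary2 (fun x y => k x y *+ m) ->
  coboundary2 (fun x y => k x y *+ n) -> coboundary2 k.
Proof.
move=> mn km kn; have [[q [r e]]|[q [r e]]] := coprime_Bezout mn.
  apply: eq_coboundary2 (coboundary2D (coboundary2Mn q km)
    (coboundary2N (coboundary2Mn r kn))) => x y.
  by rewrite -!mulrnA mulnC e mulrS [(n * r)%N]mulnC; zmod.
apply: eq_coboundary2 (coboundary2D (coboundary2Mn r kn)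
  (coboundary2N (coboundary2Mn q km))) => x y.
by rewrite -!mulrnA [(n * r)%N]mulnC e mulrS [(m * q)%N]mulnC; zmod.
Qed.

Lemma kills_ab_hom (G : groupType) (T : zmodType) (phi : G -> T) a :
  kills_ab G a -> (forall x y, phi (x * y)%g = phi x + phi y) ->
  forall x, phi x *+ a = 0.
Proof.
move=> Ga phiM x.
have phi1 : phi 1%g = 0.
  by apply: (eq_by (esym (phiM 1%g 1%g))); rewrite mulg1; zmod.
have phiV y : phi y^-1%g = - phi y.
  by apply: (eq_by (esym (phiM y y^-1%g))); rewrite mulgV phi1; zmod.
have phiX n : phi (x ^+ n)%g = phi x *+ n.
  by elim: n => [|n IHn]; rewrite ?expg0 // expgS phiM IHn mulrS.
rewrite -phiX; move: (x ^+ a)%g (Ga x); apply: comm_min.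
  by split=> // y z /= y0 z0; rewrite phiM phiV y0 z0; zmod.
move=> y z _ _ /=; rewrite commgEl conjgE !phiM !phiV; zmod.
Qed.

(** The coupling hypothesis says that h |-> [f (-, -, h)] is a homomorphism from
    H to H^2(G; T).  It factors through the abelianization of H, so its values
    are killed by b as well as by n. *)
Lemma kills_H2_hom (G H : groupType) (T : zmodType) (f : G -> G -> H -> T)
    (k : G -> H -> H -> T) b n :
  kills_ab H b -> kills_H2 G n -> coprime n b ->
  (forall h, cocycle2 (fun x y => f x y h)) ->
  (forall h h' x y, f x y h + f x y h' - f x y (h * h')%g =
                    cobound (fun x => k x h h') x y) ->
  forall h, coboundary2 (fun x y => f x y h).
Proof.
move=> Hb Gn nb fc fk h.
pose Z h := coboundary2 (fun x y => f x y h).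
have ZM h1 h2 : coboundary2 (fun x y => f x y h1 + f x y h2 - f x y (h1 * h2)%g).
  by apply: eq_coboundary2 (coboundary2_cobound (fun x => k x h1 h2)) => x y;
    rewrite fk.
have Z1 : Z 1%g.
  by apply: eq_coboundary2 (ZM 1%g 1%g) => x y; rewrite mulg1; zmod.
have Zmul h1 h2 : Z h1 -> Z h2 -> Z (h1 * h2)%g.
  move=> Z1' Z2; apply: eq_coboundary2 (coboundary2D (coboundary2D Z1' Z2)
    (coboundary2N (ZM h1 h2))) => x y; zmod.
have Zinv h1 : Z h1 -> Z h1^-1%g.
  move=> Zh1; apply: eq_coboundary2 (coboundary2D (coboundary2D
    (ZM h1 h1^-1%g) (coboundary2N Zh1)) Z1) => x y; rewrite mulgV; zmod.
have Zcomm (h1 h2 : H) : Z [~ h1, h2]%g.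
  apply: eq_coboundary2 (coboundary2D (coboundary2D (ZM (h2 * h1)%g [~ h1, h2]%g)
    (coboundary2N (ZM h1 h2))) (ZM h2 h1)) => x y.
  have -> : (h2 * h1 * [~ h1, h2] = h1 * h2)%g by rewrite [RHS]commgC.
  by zmod.
have Zb : Z (h ^+ b)%g.
  move: (h ^+ b)%g (Hb h); apply: comm_min => [|h1 h2 _ _]; last exact: Zcomm.
  by split=> // h1 h2 Zh1 Zh2; apply: Zmul => //; exact: Zinv.
have ZX m : coboundary2 (fun x y => f x y h *+ m - f x y (h ^+ m)%g).
  elim: m => [|m IHm].
    by apply: eq_coboundary2 (coboundary2N Z1) => x y; rewrite expg0 mulr0n; zmod.
  apply: eq_coboundary2 (coboundary2D IHm (ZM h (h ^+ m)%g)) => x y.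
  by rewrite -expgS mulrS; zmod.
apply: (coprime_coboundary2 nb); first exact: Gn.
by apply: eq_coboundary2 (coboundary2D (ZX b) Zb) => x y; zmod.
Qed.

(** The pair (f, k) is a 3-cocycle of G x H in bidegrees (2, 1) and (1, 2).
    First f is made trivial by [kills_H2_hom].  What remains of k is then
    additive in g, that is, a 2-cocycle of H with values in Hom(G, T), and it is
    killed by a and by nH. *)
Lemma kunneth_coboundary (G H : groupType) (T : zmodType)
    (f : G -> G -> H -> T) (k : G -> H -> H -> T) a b nG nH :
  kills_ab G a -> kills_ab H b -> kills_H2 G nG -> kills_H2 H nH ->
  coprime a b -> coprime nG b -> coprime a nH ->
  (forall h, cocycle2 (fun x y => f x y h)) -> (forall x, cocycle2 (k x)) ->
  (forall h h' x y, f x y h + f x y h' - f x y (h * h')%g =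
                    cobound (fun x => k x h h') x y) ->
  exists t : G -> H -> T,
    (forall h x y, f x y h = cobound (fun x => t x h) x y) /\
    (forall x h h', k x h h' = cobound (t x) h h').
Proof.
move=> Ga Hb GnG HnH ab nGb anH fc kc fk.
have /choice[t1 ft1] := kills_H2_hom Hb GnG nGb fc fk.
pose k1 x h h' := k x h h' - cobound (fun h => t1 h x) h h'.
have k1c x : cocycle2 (k1 x).
  move=> h1 h2 h3; apply: (eq_by (kc x h1 h2 h3)).
  by rewrite /k1 /cobound !mulgA; zmod.
have k1M h h' x y : k1 (x * y)%g h h' = k1 x h h' + k1 y h h'.
  apply: (eq_by (fk h h' x y)); rewrite !ft1 /k1 /cobound; zmod.
have k1a x h h' : k1 x h h' *+ a = 0.
  exact: (kills_ab_hom Ga (phi := fun x => k1 x h h')).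
have /choice[t2 kt2] := fun x => HnH T (k1 x) (k1c x).
(* A cochain t2 that bounds a multiple of k1 need not be additive in g, but its
   defect of additivity is a homomorphism in h, so b kills it.  Hence the
   Bezout relation is taken between a and nH * b: the factor b is kept aside. *)
have [t3 kt3] : exists t3 : G -> H -> T,
    (forall x h h', k1 x h h' = cobound (t3 x) h h' *+ b) /\
    (forall x y h h', cobound (t3 x) h h' + cobound (t3 y) h h' -
                      cobound (t3 (x * y)%g) h h' = 0).
  have anHb : coprime a (nH * b) by rewrite coprimeMr anH.
  have t2M x y h h' : cobound (t2 x) h h' + cobound (t2 y) h h' -
                      cobound (t2 (x * y)%g) h h' = 0.
    by rewrite -!kt2 k1M (mulrnDl nH (k1 x h h') (k1 y h h')); zmod.
  have coboundMn (t : H -> T) m h h' :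
    cobound (fun h => t h *+ m) h h' = cobound t h h' *+ m.
    by rewrite /cobound mulrnBl mulrnDl.
  have coboundN (t : H -> T) h h' : cobound (fun h => - t h) h h' = - cobound t h h'.
    by rewrite /cobound; zmod.
  have k1r x h h' r : cobound (fun h => t2 x h *+ r) h h' *+ b =
      k1 x h h' *+ (r * (nH * b)).
    by rewrite coboundMn -kt2 -!mulrnA mulnCA mulnA.
  have t2rM r x y h h' : cobound (fun h => t2 x h *+ r) h h' +
      cobound (fun h => t2 y h *+ r) h h' -
      cobound (fun h => t2 (x * y)%g h *+ r) h h' = 0.
    by rewrite !coboundMn -mulrnDl -mulrnBl t2M mul0rn.
  have k1qa x h h' q : k1 x h h' *+ (q * a) = 0.
    by rewrite mulnC mulrnA k1a mul0rn.
  have [[q [r e]]|[q [r e]]] := coprime_Bezout anHb.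
    exists (fun x h => - (t2 x h *+ r)); split=> [x h h'|x y h h'].
      rewrite coboundN mulNrn k1r.
      by apply: (eq_by (k1qa x h h' q)); rewrite e mulrS; zmod.
    by rewrite !coboundN; apply: (eq_by (esym (t2rM r x y h h'))); zmod.
  exists (fun x h => t2 x h *+ r); split=> // x h h'.
  by rewrite k1r e mulrS k1qa addr0.
have t3b h x y : (t3 x h + t3 y h - t3 (x * y)%g h) *+ b = 0.
  apply: (kills_ab_hom Hb (phi := fun h => t3 x h + t3 y h - t3 (x * y)%g h)).
  by move=> h1 h2; apply: (eq_by (esym (kt3.2 x y h1 h2))); rewrite /cobound; zmod.
exists (fun x h => t1 h x + t3 x h *+ b); split=> [h x y|x h h'].
  apply: (eq_by (esym (t3b h x y))).
  by rewrite ft1 mulrnBl mulrnDl /cobound; zmod.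
apply: (eq_by (kt3.1 x h h')); rewrite /k1 /cobound mulrnBl mulrnDl; zmod.
Qed.

End Cohomology.

(** * Integers that kill abelianizations and second cohomology *)

Section Additive.
Variable A : groupType.

Definition additive_group (cA : abelian_group A) : Type := A.

Variable cA : abelian_group A.

HB.instance Definition _ := Choice.on (additive_group cA).

Let add (x y : additive_group cA) : additive_group cA := (x * y)%g.
Let zero : additive_group cA := 1%g.
Let opp (x : additive_group cA) : additive_group cA := x^-1%g.

Let addA : associative add. Proof. exact: mulgA. Qed.
Let addC : commutative add. Proof. exact: cA. Qed.
Let add0 : left_id zero add. Proof. exact: mul1g. Qed.
Let addN : left_inverse zero opp add. Proof. exact: mulVg. Qed.

HB.instance Definition _ :=
  GRing.isZmodule.Build (additive_group cA) addA addC add0 addN.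

Lemma additive_mulrn (x : additive_group cA) n : (x *+ n)%R = (x ^+ n)%g :> A.
Proof. by elim: n => // n IHn; rewrite mulrS expgS -IHn. Qed.

End Additive.

Section FiniteGroups.
Local Open Scope ring_scope.

Lemma finite_group_sum (G : groupType) : finite_group G ->
  exists2 e : seq G, size e = group_order G &
    forall (x : G) (T : zmodType) (F : G -> T),
      \sum_(z <- e) F (x * z)%g = \sum_(z <- e) F z.
Proof.
move=> finG; exists (fset_set [set: G]%classic) => [//|x T F].
rewrite -(big_map (fun z => x * z)%g xpredT F); apply: perm_big.
apply: uniq_perm; rewrite ?fset_uniq ?map_inj_uniq ?fset_uniq //.
  exact: mulgI.
move=> y; rewrite in_fset_set // [RHS]mem_set //.
apply/mapP; exists (x^-1 * y)%g; last by rewrite mulVKg.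
by rewrite in_fset_set // mem_set.
Qed.

(** Summing the cocycle identity over its last variable. *)
Lemma finite_kills_H2 (G : groupType) :
  finite_group G -> kills_H2 G (group_order G).
Proof.
move=> /finite_group_sum[e e_size e_sum] T k kc.
exists (fun x => \sum_(z <- e) k x z) => x y.
rewrite /cobound -[X in _ + X - _](e_sum 1%g T (k y)).
have -> : k x y *+ group_order G = \sum_(z <- e) k x y.
  by rewrite big_const_seq count_predT e_size iter_addr addr0.
rewrite -(e_sum y T (k x)) -big_split -sumrB /=.
by apply: eq_bigr => z _; apply: (eq_by (kc x y z)); rewrite mul1g; zmod.
Qed.

(** Translating the sum of f over G by x adds the order of G times f x; this
    gives the exponent without Lagrange's theorem. *)
Lemma finite_abelian_image (G A : groupType) (f : group_hom G A) x :
  finite_group G -> abelian_group A -> (f x ^+ group_order G = 1)%g.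
Proof.
move=> /finite_group_sum[e e_size e_sum] cA.
have := e_sum x (additive_group cA) f.
have -> : \sum_(z <- e) (f (x * z)%g : additive_group cA) =
          \sum_(z <- e) ((f x : additive_group cA) + f z).
  by apply: eq_bigr => z _; rewrite gmulfM.
rewrite big_split /= big_const_seq count_predT e_size iter_addr addr0.
by move/(canRL (addrK _)); rewrite subrr => h; rewrite -(@additive_mulrn _ cA).
Qed.

End FiniteGroups.

Section Abelianization.
Local Open Scope group_scope.

Lemma abelianization_abelian (G : groupType) : abelian_group (abelianization G).
Proof.
move=> x y; have [[u <-] [v <-]] := (quotient_hom_surj x, quotient_hom_surj y).
by apply/quotient_hom_commute; exact: comm_gen.
Qed.

Lemma finite_abelianization (G : groupType) :
  finite_group G -> finite_group (abelianization G).
Proof.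
move=> finG; rewrite /finite_group.
have -> : [set: abelianization G]%classic =
    ((fun x => quotient_hom (comm whole whole) x) @` [set: G])%classic.
  apply/esym/seteqP; split=> // y _.
  by have [x <-] := quotient_hom_surj y; exists x.
exact: finite_image.
Qed.

Lemma finite_kills_ab (G : groupType) :
  finite_group G -> kills_ab G (group_order G).
Proof.
move=> finG x; apply/quotient_hom_eq1; rewrite gmulfXn.
by apply: finite_abelian_image => //; exact: abelianization_abelian.
Qed.

Lemma abelianization_kills_ab (G : groupType) :
  finite_group G -> kills_ab G (group_order (abelianization G)).
Proof.
move=> finG x; apply/quotient_hom_eq1; rewrite gmulfXn.
apply: (@finite_abelian_image _ _ idfun (quotient_hom _ x)).
  exact: finite_abelianization.
exact: abelianization_abelian.
Qed.

Lemma kills_ab_gcd (G : groupType) m n :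
  kills_ab G m -> kills_ab G n -> kills_ab G (gcdn m n).
Proof.
case: m => [|m] Gm Gn x; first by rewrite gcd0n.
have [r _ /dvdnP[q e]] := Bezoutl n (ltn0Sn m).
have -> : x ^+ gcdn m.+1 n = x ^+ m.+1 ^+ q * (x ^+ n ^+ r)^-1.
  by rewrite -!expgnA mulnC -e expgnDr [(n * r)%N]mulnC mulgK.
have hX y s : comm (@whole G) whole y -> comm (@whole G) whole (y ^+ s).
  move=> hy; elim: s => [|s IHs]; first exact: subgroup1.
  by rewrite expgS; exact: subgroupM.
by apply: subgroupF; apply: hX.
Qed.

End Abelianization.

Section CentralExtension.
Local Open Scope ring_scope.
Variables (H : groupType) (T : zmodType) (k : H -> H -> T).

Definition normalized := k 1%g 1%g = 0.

(** The cocycle hypotheses are arguments so that the group structure may depend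
    on them. *)
Definition central_ext (kc : cocycle2 k) (k1 : normalized) : Type := (T * H)%type.

Variables (kc : cocycle2 k) (k1 : normalized).

Lemma cocycle_1l y : k 1%g y = 0.
Proof.
by apply: (eq_by (esym (kc 1%g 1%g y))); rewrite !mul1g k1; zmod.
Qed.

Lemma cocycle_1r x : k x 1%g = 0.
Proof.
by apply: (eq_by (kc x 1%g 1%g)); rewrite !mulg1 k1; zmod.
Qed.

Lemma cocycle_inv x : k x^-1%g x = k x x^-1%g.
Proof.
apply: (eq_by (esym (kc x x^-1%g x))).
by rewrite mulgV mulVg cocycle_1l cocycle_1r; zmod.
Qed.

Local Notation E := (central_ext kc k1).

HB.instance Definition _ := Choice.on E.

Let mul (u v : E) : E := (u.1 + v.1 + k u.2 v.2, (u.2 * v.2)%g).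
Let e1 : E := (0, 1%g).
Let inv (u : E) : E := (- u.1 - k u.2 u.2^-1%g, u.2^-1%g).

Let mulA : associative mul.
Proof.
move=> [s x] [t y] [u z]; congr (_, _); rewrite /= ?mulgA //.
by apply: (eq_by (esym (kc x y z))); zmod.
Qed.

Let mul1 : left_id e1 mul.
Proof. by move=> [s x]; congr (_, _); rewrite /= ?mul1g // cocycle_1l; zmod. Qed.

Let mulr1 : right_id e1 mul.
Proof. by move=> [s x]; congr (_, _); rewrite /= ?mulg1 // cocycle_1r; zmod. Qed.

Let mulV : left_inverse e1 inv mul.
Proof.
by move=> [s x]; congr (_, _); rewrite /= ?mulVg // cocycle_inv; zmod.
Qed.

Let mulrV : right_inverse e1 inv mul.
Proof. by move=> [s x]; congr (_, _); rewrite /= ?mulgV //; zmod. Qed.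

HB.instance Definition _ := isGroup.Build E mulA mul1 mulr1 mulV mulrV.

Lemma central_ext_morphism : monoid.monoid_morphism (fun u : E => u.2).
Proof. by []. Qed.

Definition central_ext_proj : group_hom E H := hom_of central_ext_morphism.

(** The central extension defined by k splits over a free group. *)
Lemma free_cocycle_trivial (F : groupType) (p : group_hom F H) : free_group F ->
  exists t : F -> T, forall x y, t (x * y)%g = t x + t y + k (p x) (p y).
Proof.
move=> freeF.
have [|phi phiE] := @free_lift F E H central_ext_proj p freeF.
  by move=> y; exists ((0, y) : E).
by exists (fun x => (phi x).1) => x y; rewrite gmulfM /= -!phiE.
Qed.

End CentralExtension.

Section PresentationKillsH2.
Local Open Scope ring_scope.

Lemma image_lower_central (F H : groupType) (p : group_hom F H) :
  (forall h, exists x, p x = h) ->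
  forall h, comm whole whole h ->
  exists2 x, comm (@whole F) whole x & p x = h.
Proof.
move=> p_surj; apply: (comm_min (N := [set h | exists2 x,
  comm (@whole F) whole x & p x = h]%classic)) => [|h1 h2 _ _].
  split=> [|_ _ [u hu <-] [v hv <-]].
    by exists 1%g; [exact: subgroup1|rewrite gmulf1].
  by exists (u / v)%g; [exact: subgroupF|rewrite gmulfF].
have [[u <-] [v <-]] := (p_surj h1, p_surj h2).
by exists [~ u, v]%g; [exact: comm_gen|rewrite gmulfR].
Qed.

Lemma normalize_cocycle (G : groupType) (T : zmodType) (k : G -> G -> T) :
  cocycle2 k -> cocycle2 (fun x y => k x y - k 1%g 1%g).
Proof. by move=> kc x y z; apply: (eq_by (kc x y z)); zmod. Qed.

(** Over the free group the cocycle k is bounded by a function t, whose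
    restriction to the relations R is a homomorphism that vanishes on [R, F];
    the class of k is the obstruction to extending this restriction to F.  Now
    m * t vanishes on the relations in F', so it factors through R F' / F', and
    b times it extends to F through y |-> y ^ b. *)
Lemma presentation_kills_H2 (H : groupType) (P : free_presentation H) m b :
  kills_ab H b ->
  (forall r, pres_rel P r -> comm (@whole (pres_group P)) whole r ->
     comm (pres_rel P) whole (r ^+ m)%g) ->
  kills_H2 H (m * b).
Proof.
move=> Hb; have [p [p_surj kerp]] := presentation_epi P.
set F := pres_group P in p p_surj kerp *; set R := pres_rel P in kerp *.
move=> Rm T k0 k0c; pose k x y := k0 x y - k0 1%g 1%g.
have kc : cocycle2 k by exact: normalize_cocycle.
have k1 : normalized k by rewrite /normalized /k subrr.
suff [t kt] : coboundary2 (fun x y => k x y *+ (m * b)).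
  exists (fun x => t x + k0 1%g 1%g *+ (m * b)) => x y.
  by apply: (eq_by (kt x y)); rewrite /cobound /k mulrnBl; zmod.
have [t tM] := free_cocycle_trivial kc k1 p (pres_free P).
have tl r y : R r -> t (r * y)%g = t r + t y.
  by move=> /kerp pr; rewrite tM pr (cocycle_1l kc k1) addr0.
have tr r y : R r -> t (y * r)%g = t y + t r.
  by move=> /kerp pr; rewrite tM pr (cocycle_1r kc k1) addr0.
have R1 : R 1%g := subgroup1 R.
have t1 : t 1%g = 0 by apply: (eq_by (esym (tl 1%g 1%g R1))); rewrite mulg1; zmod.
have tV r : R r -> t r^-1%g = - t r.
  by move=> Rr; apply: (eq_by (esym (tl r r^-1%g Rr))); rewrite mulgV t1; zmod.
have tJ r y : R r -> t (r ^ y)%g = t r.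
  move=> Rr; have := tr _ y (normalP y Rr); rewrite -conjgC tl // => h.
  by apply: (eq_by (esym h)); zmod.
have tX r n : R r -> R (r ^+ n)%g /\ t (r ^+ n)%g = t r *+ n.
  move=> Rr; elim: n => [|n [Rn IHn]]; first by rewrite expg0.
  by rewrite expgS tl // IHn mulrS; split=> //; exact: subgroupM.
have tRF r : comm R whole r -> R r /\ t r = 0.
  move: r; apply: (comm_min (N := [set r | R r /\ t r = 0]%classic)).
    split=> // x y [Rx tx] [Ry ty]; split; first exact: subgroupF.
    by rewrite tl // tV // tx ty; zmod.
  move=> r y Rr _; split; first exact: normalR.
  by rewrite commgEl tl ?tV ?tJ //; [zmod|exact: subgroupV].
have tR2 r r' : R r -> R r' -> comm (@whole F) whole (r^-1 * r')%g ->
    t r *+ m = t r' *+ m.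
  move=> Rr Rr' h; have Rrr : R (r^-1 * r')%g.
    by apply: subgroupM => //; exact: subgroupV.
  have [_ /esym e] := tRF _ (Rm _ Rrr h); move: e.
  rewrite (tX _ _ Rrr).2 tl ?tV //; last exact: subgroupV.
  by rewrite mulrnDl mulNrn => e; apply: (eq_by e); zmod.
(* rr y is a relation congruent to y ^ b modulo F', on which the extension to F
   of b * m * t is computed. *)
have /choice[rr rrE] y : exists r, R r /\ comm (@whole F) whole (r^-1 * y ^+ b)%g.
  have [d dF pd] := image_lower_central p_surj (Hb (p y)).
  exists (y ^+ b * d^-1)%g; split; last by rewrite invgM invgK -mulgA mulVg mulg1.
  by apply/kerp; rewrite gmulfM gmulfV gmulfXn pd mulgV.
pose q := quotient_hom (comm (@whole F) whole).
have qrr y : q (rr y) = (q y ^+ b)%g.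
  by rewrite -gmulfXn; apply/quotient_hom_eq; case: (rrE y).
pose phi y := t (rr y) *+ m.
have phiM x y : phi (x * y)%g = phi x + phi y.
  rewrite -mulrnDl -tl; last by case: (rrE x).
  apply: tR2; [by case: (rrE (x * y)%g)| |].
    by apply: subgroupM; [case: (rrE x)|case: (rrE y)].
  apply/quotient_hom_eq; rewrite gmulfM !qrr [q (x * y)%g]gmulfM expgMn //.
  exact: abelianization_abelian.
have phiR r : R r -> phi r = t r *+ (m * b).
  move=> Rr; have [Rb tb] := tX r b Rr.
  rewrite mulnC mulrnA -tb; apply: tR2 => //; first by case: (rrE r).
  by case: (rrE r).
have /choice[s ps] := p_surj.
exists (fun h => phi (s h) - t (s h) *+ (m * b)) => x y.
pose r := ((s (x * y)%g)^-1 * (s x * s y))%g.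
have Rr : R r by apply/kerp; rewrite /r !gmulfM gmulfV !ps mulVg.
have := phiM (s x) (s y); have := tM (s x) (s y).
have -> : (s x * s y = s (x * y) * r)%g by rewrite mulVKg.
rewrite !ps phiM (tr _ _ Rr) (phiR _ Rr) => /(congr1 (fun z => z *+ (m * b))).
rewrite !mulrnDl /cobound => e1 e2.
by apply: (eq_by (congr2 +%R (esym e1) e2)); zmod.
Qed.

End PresentationKillsH2.

(** * The cartesian subgroup of a free product *)

Section FreeProductStructure.
Local Open Scope classical_set_scope.
Local Open Scope group_scope.

Section ProductOfNormal.
Variable G : groupType.
Implicit Types A B N C : normal_subgroup G.

Let prodn_set A B := [set z | exists2 a, A a & B (a^-1 * z)].

Lemma prodn_is_subgroup A B : is_subgroup (prodn_set A B).
Proof.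
split=> [|x y [a Aa /quotient_hom_eq ax] [b Ab /quotient_hom_eq bY]].
  by exists 1; [|rewrite mulVg]; exact: subgroup1.
exists (a / b); first exact: subgroupF.
by apply/quotient_hom_eq; rewrite !gmulfF ax bY.
Qed.

Lemma prodn_normal A B x y : prodn_set A B x -> prodn_set A B (x ^ y).
Proof.
move=> [a Aa /quotient_hom_eq ax]; exists (a ^ y); first exact: normalP.
by apply/quotient_hom_eq; rewrite !gmulfJ ax.
Qed.

Definition prodn A B : normal_subgroup G :=
  @NormalSubgroup _ (Subgroup (prodn_is_subgroup A B)) (@prodn_normal A B).

Lemma sub_prodnl A B : A `<=` prodn A B.
Proof. by move=> a Aa; exists a => //; rewrite mulVg; exact: subgroup1. Qed.

Lemma sub_prodnr A B : B `<=` prodn A B.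
Proof. by move=> b Bb; exists 1; [exact: subgroup1|rewrite invg1 mul1g]. Qed.

Lemma comm_prodn A B N C :
  A `<=` prodn N B -> N `<=` C -> comm A whole `<=` prodn (comm C whole) (comm B whole).
Proof.
move=> hA NC; apply: comm_min; first exact: subgroupP.
move=> a g /hA[n Nn Bna] _; rewrite -[a](mulVKg n) commg_mulgL.
apply: subgroupM; [apply: normalP; apply: sub_prodnl|apply: sub_prodnr];
  by apply: comm_gen => //; exact: NC.
Qed.

End ProductOfNormal.

Section Structure.
Variables G H : groupType.
Local Notation F := (free_product G H).
Local Notation i1 := (inl_hom G H).
Local Notation i2 := (inr_hom G H).
Local Notation q1 := (proj_l G H).
Local Notation q2 := (proj_r G H).
Local Notation D := (cartesian G H).

Lemma cartesianP z : D z <-> q1 z = 1 /\ q2 z = 1.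
Proof. by []. Qed.

Lemma cartesian_comm x y : D [~ i1 x, i2 y].
Proof.
by apply/cartesianP; rewrite !gmulfR proj_lE proj_l1 proj_r1 proj_rE commg1 comm1g.
Qed.

Lemma cartesian_rem z : D ((i1 (q1 z) * i2 (q2 z))^-1 * z).
Proof.
apply/cartesianP; rewrite !gmulfM !gmulfV !gmulfM proj_lE proj_l1 proj_r1 proj_rE.
by rewrite mulg1 mul1g !mulVg.
Qed.

Lemma normal_of_conj (N : set F) : is_subgroup N ->
  (forall x z, N z -> N (z ^ i1 x)) -> (forall y z, N z -> N (z ^ i2 y)) ->
  forall z w, N z -> N (z ^ w).
Proof.
move=> sN N1 N2 z w; move: w z; apply: free_product_recr => [z|w x IH z|w y IH z].
- by rewrite conjg1.
- by move=> Nz; rewrite conjgM; apply: N1; exact: IH.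
- by move=> Nz; rewrite conjgM; apply: N2; exact: IH.
Qed.

(** S stands for the normal closure of R1 and R2.  Modulo B, each of R1 and R2
    commutes with the other factor, so the elements that are congruent to a
    product of an element of R1 and one of R2 form a normal subgroup, which
    contains S.  On the cartesian subgroup both factors of the product are
    trivial. *)
Lemma cartesian_generation (R1 : normal_subgroup G) (R2 : normal_subgroup H)
    (B : normal_subgroup F) (S : set F) :
  (forall N : normal_subgroup F, (forall r, R1 r -> N (i1 r)) ->
     (forall r, R2 r -> N (i2 r)) -> S `<=` N) ->
  (forall r y, R1 r -> B [~ i1 r, i2 y]) ->
  (forall x r, R2 r -> B [~ i1 x, i2 r]) ->
  forall z, S z -> D z -> B z.
Proof.
move=> minS B1 B2; pose q := quotient_hom B.
pose N := [set z | [/\ R1 (q1 z), R2 (q2 z) &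
                       q z = q (i1 (q1 z)) * q (i2 (q2 z))]].
have c1 r y : R1 r -> commute (q (i1 r)) (q (i2 y)).
  by move=> Rr; apply/quotient_hom_commute; exact: B1.
have c2 x r : R2 r -> commute (q (i1 x)) (q (i2 r)).
  by move=> Rr; apply/quotient_hom_commute; exact: B2.
have sN : is_subgroup N.
  split=> [|u v [Ru1 Ru2 eu] [Rv1 Rv2 ev]].
    by split; rewrite !gmulf1 ?mulg1 //; exact: subgroup1.
  have cuv : commute (q (i2 (q2 u / q2 v))) (q (i1 (q1 v)^-1)).
    by apply: commute_sym; apply: c1; exact: subgroupV.
  split; rewrite !gmulfF; try exact: subgroupF.
  rewrite !gmulfF !gmulfV in cuv; rewrite eu ev invgM -!mulgA; congr (_ * _).
  by rewrite mulgA.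
have N1 x z : N z -> N (z ^ i1 x).
  move=> [Rz1 Rz2 ez]; split; rewrite ?gmulfJ ?proj_lE ?proj_r1 ?conjg1 //.
    exact: normalP.
  rewrite !gmulf1 conjg1 ez conjMg; congr (_ * _).
  by apply: commute_conjg; apply: commute_sym; exact: c2.
have N2 y z : N z -> N (z ^ i2 y).
  move=> [Rz1 Rz2 ez]; split; rewrite ?gmulfJ ?proj_l1 ?proj_rE ?conjg1 //.
    exact: normalP.
  rewrite !gmulf1 conjg1 ez conjMg; congr (_ * _).
  by apply: commute_conjg; exact: c1.
pose NN := @NormalSubgroup _ (Subgroup sN) (normal_of_conj sN N1 N2).
have SN : S `<=` NN.
  apply: minS => r Rr; split; rewrite ?proj_lE ?proj_l1 ?proj_r1 ?proj_rE //;
    rewrite ?gmulf1 ?mulg1 ?mul1g //; exact: subgroup1.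
move=> z /SN[_ _ qz] /cartesianP[z1 z2].
by apply/quotient_hom_eq1; rewrite -/q qz z1 z2 !gmulf1 mulg1.
Qed.

(** The case where all elements are relations. *)
Lemma cartesian_min (B : normal_subgroup F) :
  (forall x y, B [~ i1 x, i2 y]) -> D `<=` B.
Proof.
move=> hB z; apply: (@cartesian_generation whole whole B setT) => //.
move=> N N1 N2 w _; apply: (@free_product_ind _ _ N) => //.
- exact: subgroupP.
- by move=> x; exact: N1.
- by move=> x; exact: N2.
Qed.

Local Notation D_ k := (iter_comm D k).

(** Hall-Witt again: for k = 0 this is the definition of the cartesian
    subgroup, and each further commutator in the second factor costs one
    commutator of D with the whole group. *)
Lemma cartesian_comm_lower_central k u x :
  lower_central H k.+1 u -> D_ k [~ i2 u, i1 x].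
Proof.
elim: k u x => [|k IHk] u x.
  by move=> _; rewrite -invgR; apply: subgroupV; exact: cartesian_comm.
move=> hu; move: u hu x.
apply: (comm_min (N := [set u | forall x, D_ k.+1 [~ i2 u, i1 x]])).
  have [h1 hF] := centralizer_mod_subgroup (range i1) (D_ k.+1).
  split=> [x|u v hu hv x]; first by rewrite gmulf1; apply: h1; exists x.
  by rewrite gmulfF; apply: hF => [_ [y _ <-]|_ [y _ <-]|]; [exact: hu|exact: hv|exists x].
move=> u v hu _ x; rewrite gmulfR; apply: Hall_Witt_mem.
  apply: lower_central_comm; last exact: hom_lower_central.
  rewrite -!gmulfV -invgR; apply: subgroupV; exact: cartesian_comm.
apply: comm_gen => //; rewrite -!gmulfV -invgR; apply: subgroupV.
by apply: IHk; exact: subgroupV.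
Qed.

(** Modulo D_(k+1), replacing z and w by their second projections does not
    change [z, w]: the quotient of z by its projection is central, and the
    projection of z lies deep enough in the lower central series to commute
    with the first factor and with D. *)
Lemma kernel_proj_l_iter_comm k z : iter_comm (kernel q1) k.+1 z ->
  D_ k ((i2 (q2 z))^-1 * z).
Proof.
elim: k z => [|k IHk] z.
  move=> /iter_comm_subl z1; apply/cartesianP.
  by rewrite !gmulfM !gmulfV proj_l1 proj_rE mulVg invg1 mul1g.
pose q := quotient_hom (D_ k.+1).
move=> hz; apply/quotient_hom_eq; rewrite -/q; move: z hz.
apply: (comm_min (N := [set z | q (i2 (q2 z)) = q z])).
  exact: (@eq_hom_subgroup _ _ (q \o i2 \o q2) q).
move=> z w hz _; change (q (i2 (q2 [~ z, w])) = q [~ z, w]).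
change (iter_comm (kernel q1) k.+1 z) in hz.
have hy : lower_central H k.+2 (q2 z).
  by apply: hom_lower_central; have [] := iter_comm_sub hz.
have qD d u : D d -> lower_central F k.+1 u -> commute (q u) (q d).
  move=> Dd hu; apply: commute_sym.
  by apply/quotient_hom_commute; exact: lower_central_comm.
have hi2 u : lower_central H k.+2 u -> lower_central F k.+1 (i2 u).
  by move=> hu; apply: (@lower_central_le _ k.+1 k.+2) => //; exact: hom_lower_central.
have rem_central v : commute (q ((i2 (q2 z))^-1 * z)) (q v).
  by apply/quotient_hom_commute; apply: comm_gen => //; exact: IHk.
rewrite [RHS]gmulfR -[in q z](mulVKg (i2 (q2 z)) z) [q (_ * (_ * z))]gmulfM.
rewrite commg_mulgL (commute_commg1 (rem_central w)) mulg1.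
rewrite (@commute_conjg _ [~ _, _]); last first.
  by apply: commute_sym; rewrite -gmulfR; exact: rem_central.
rewrite -[in q w](mulVKg (i1 (q1 w) * i2 (q2 w)) w) [q (_ * (_ * w))]gmulfM.
rewrite [q (i1 _ * i2 _)]gmulfM commg_mulgR.
rewrite (@commute_commg1 _ (q (i2 _)) (q (_ * w))) ?mul1g; last first.
  by apply: qD; [exact: cartesian_rem|exact: hi2].
rewrite commg_mulgR (@commute_commg1 _ (q (i2 _)) (q (i1 _))); last first.
  apply/quotient_hom_commute; exact: cartesian_comm_lower_central.
rewrite conj1g mulg1 -!gmulfR; apply/esym/commute_conjg.
by apply: qD; [exact: cartesian_rem|apply: hi2; rewrite gmulfR; exact: normalR].
Qed.

(** Comparing the identity with the first projection puts z in
    [ker q1, _(k+1) F], to which [kernel_proj_l_iter_comm] applies. *)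
Lemma cartesian_lower_central k z :
  D z -> lower_central F k.+2 z -> D_ k z.
Proof.
move=> /cartesianP[z1 z2] hz.
have hN : iter_comm (kernel q1) k.+1 z.
  have := @congruent_homs_lower_central _ _ (i1 \o q1) idfun (kernel q1) _ k.+1 z hz.
  rewrite /= z1 gmulf1 invg1 mul1g; apply=> x.
  by change (q1 ((i1 (q1 x))^-1 * x) = 1); rewrite gmulfM gmulfV proj_lE mulVg.
by have := kernel_proj_l_iter_comm hN; rewrite z2 gmulf1 invg1 mul1g.
Qed.

Section SplitCartesian.
Variables (K L : groupType) (p1 : group_hom G K) (p2 : group_hom H L).
Hypothesis p1_surj : forall x, exists y, p1 y = x.
Hypothesis p2_surj : forall x, exists y, p2 y = x.
Local Notation S := (kernel (free_product_map p1 p2)).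

Lemma factor_epi (A B C : groupType) (p : group_hom A B) (f : group_hom A C) :
  (forall y, exists x, p x = y) -> (forall x, p x = 1 -> f x = 1) ->
  exists g : group_hom B C, forall x, g (p x) = f x.
Proof.
move=> /choice[s ps] pf.
have gE x : f (s (p x)) = f x.
  apply/esym; rewrite -[s (p x)](mulVKg x) gmulfM (pf (_ * _)) ?mulg1 //.
  by rewrite gmulfM gmulfV ps mulVg.
have gM : monoid.monoid_morphism (fun y => f (s y)).
  split=> [|y z]; first by have := gE 1; rewrite !gmulf1.
  by rewrite -[y]ps -[z]ps -gmulfM !gE gmulfM.
by exists (hom_of gM).
Qed.

(** By the universal property, the quotient of F by N receives the free product
    of G and H. *)
Lemma kernel_free_product_map_min (N : normal_subgroup F) :
  (forall r, p1 r = 1 -> N (i1 r)) -> (forall r, p2 r = 1 -> N (i2 r)) ->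
  S `<=` N.
Proof.
move=> N1 N2 z Sz; pose q := quotient_hom N.
have [|g1 g1E] := factor_epi (f := q \o i1) p1_surj.
  by move=> r /N1/quotient_hom_eq1.
have [|g2 g2E] := factor_epi (f := q \o i2) p2_surj.
  by move=> r /N2/quotient_hom_eq1.
apply/quotient_hom_eq1; rewrite -/q.
rewrite -(eq_hom_free_product (f := copair g1 g2 \o free_product_map p1 p2)).
- by rewrite /= Sz gmulf1.
- by move=> x; rewrite /= free_product_mapl copair_inl g1E.
- by move=> x; rewrite /= free_product_mapr copair_inr g2E.
Qed.

Lemma cartesian_kernel_generation (B : normal_subgroup F) :
  (forall r y, p1 r = 1 -> B [~ i1 r, i2 y]) ->
  (forall x r, p2 r = 1 -> B [~ i1 x, i2 r]) ->
  forall z, S z -> D z -> B z.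
Proof.
move=> B1 B2; apply: (@cartesian_generation (kernel p1) (kernel p2)) => //.
by move=> N N1 N2; exact: kernel_free_product_map_min.
Qed.

(** The generators of [cartesian_generation] are commutators with a relation. *)
Lemma cartesian_kernel z : S z -> D z -> comm S whole z.
Proof.
apply: cartesian_kernel_generation => [r y p1r|x r p2r].
  apply: comm_gen => //.
  by change (free_product_map p1 p2 (i1 r) = 1); rewrite free_product_mapl p1r gmulf1.
rewrite -invgR; apply: subgroupV; apply: comm_gen => //.
by change (free_product_map p1 p2 (i2 r) = 1); rewrite free_product_mapr p2r gmulf1.
Qed.

Lemma kills_ab_epi (A B C : groupType) (p : group_hom A B) (c : group_hom A C) a :
  (forall y, exists x, p x = y) -> kills_ab B a ->
  (forall x y, commute (c x) (c y)) -> (forall x, p x = 1 -> c x = 1) ->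
  forall x, c x ^+ a = 1.
Proof.
move=> p_surj Ba cC pc x.
have [d dA pd] := image_lower_central p_surj (Ba (p x)).
have cd : c d = 1.
  move: d dA {pd}; apply: (@comm_min _ _ _ (kernel c)).
    exact: subgroupP.
  by move=> u v _ _; change (c [~ u, v] = 1); rewrite gmulfR; exact: commute_commg1.
rewrite -gmulfXn -[x ^+ a](mulgVK d) gmulfM cd mulg1; apply: pc.
by rewrite gmulfM gmulfV gmulfXn pd mulgV.
Qed.

(** Modulo S_1 D_1 the commutator [x, y] is bimultiplicative and trivial on
    relations, so it is killed by a and by b.  This gives the case k = 1, which
    is then applied to itself. *)
Lemma cartesian_split a b k : kills_ab K a -> kills_ab L b -> coprime a b ->
  D `<=` prodn (comm S whole) (D_ k).
Proof.
move=> Ka Lb ab.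
have base : D `<=` prodn (comm S whole) (comm D whole).
  set B := prodn _ _; pose q := quotient_hom B.
  have Dc d z : D d -> commute (q d) (q z).
    by move=> Dd; apply/quotient_hom_commute/sub_prodnr; exact: comm_gen.
  have xyC x y x' y' : commute (q [~ i1 x, i2 y]) (q [~ i1 x', i2 y']).
    by apply: Dc; exact: cartesian_comm.
  apply: cartesian_min => x y.
  have e1 : q [~ i1 x, i2 y] ^+ a = 1.
    have cM : monoid.monoid_morphism (fun x => q [~ i1 x, i2 y]).
      split=> [|u v]; first by rewrite gmulf1 comm1g gmulf1.
      rewrite [i1 (u * v)]gmulfM commg_mulgL gmulfM gmulfJ; congr (_ * _).
      by apply: commute_conjg; apply: Dc; exact: cartesian_comm.
    apply: (@kills_ab_epi _ _ _ p1 (hom_of cM)) => // [u v|r p1r]; first exact: xyC.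
    change (q [~ i1 r, i2 y] = 1); apply/quotient_hom_eq1; apply: sub_prodnl.
    apply: comm_gen => //.
    by change (free_product_map p1 p2 (i1 r) = 1); rewrite free_product_mapl p1r gmulf1.
  have e2 : q [~ i1 x, i2 y] ^+ b = 1.
    have cM : monoid.monoid_morphism (fun y => q [~ i1 x, i2 y]).
      split=> [|u v]; first by rewrite gmulf1 commg1 gmulf1.
      rewrite [i2 (u * v)]gmulfM commg_mulgR gmulfM gmulfJ commute_conjg; first exact: xyC.
      by apply: Dc; exact: cartesian_comm.
    apply: (@kills_ab_epi _ _ _ p2 (hom_of cM)) => // [u v|r p2r]; first exact: xyC.
    change (q [~ i1 x, i2 r] = 1); apply/quotient_hom_eq1; apply: sub_prodnl; rewrite -invgR; apply: subgroupV.
    apply: comm_gen => //.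
    by change (free_product_map p1 p2 (i2 r) = 1); rewrite free_product_mapr p2r gmulf1.
  apply/quotient_hom_eq1; rewrite -/q; move: (q _) e1 e2 => u ua ub.
  have ux n m : u ^+ m = 1 -> u ^+ (n * m) = 1.
    by move=> um; rewrite mulnC expgnA um expg1n.
  have [[s [t e]]|[s [t e]]] := coprime_Bezout ab.
    by have := ux s _ ua; rewrite e expgS ux // mulg1.
  by have := ux t _ ub; rewrite e expgS ux // mulg1.
have step j : D_ j `<=` prodn (comm S whole) (D_ j.+1).
  elim: j => [|j IHj] //; exact: comm_prodn IHj (@comm_subl _ _ _).
elim: k => [|k IHk]; first exact: sub_prodnr.
move=> z /IHk[s Ss /step[t St Dz]]; exists (s * t); first exact: subgroupM.
by rewrite invgM -mulgA.
Qed.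

End SplitCartesian.

End Structure.
End FreeProductStructure.

(** * Extending crossed pairings to the cartesian subgroup *)

Section CrossedPairing.
Local Open Scope classical_set_scope.
Local Open Scope group_scope.

Variables (G H E : groupType) (j1 : group_hom G E) (j2 : group_hom H E).
Variables (U : subgroup E) (b : G -> H -> E).

(** These are the identities of (x, y) |-> [j1 x, j2 y]. *)
Record crossed_pairing : Prop := CrossedPairing {
  crossed_mulL : forall x x' y, b (x * x') y = b x y ^ j1 x' * b x' y;
  crossed_mulR : forall x y y', b x (y * y') = b x y' * b x y ^ j2 y' }.

Hypothesis bP : crossed_pairing.
Hypothesis Ub : forall x y, U (b x y).
Hypothesis UJ1 : forall u x, U u -> U (u ^ j1 x).
Hypothesis UJ2 : forall u y, U u -> U (u ^ j2 y).
Hypothesis Ucomm : forall u x y, U u -> u ^ [~ j1 x, j2 y] = u ^ b x y.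

Local Notation F := (free_product G H).
Local Notation i1 := (inl_hom G H).
Local Notation i2 := (inr_hom G H).
Local Notation D := (cartesian G H).
Local Notation state := (G * H * E)%type.

Lemma crossed_1l y : b 1 y = 1.
Proof.
have := crossed_mulL bP 1 1 y; rewrite mulg1 gmulf1 conjg1 => /eqP.
by rewrite -{1}[b 1 y]mulg1 => /eqP/mulgI.
Qed.

Lemma crossed_1r x : b x 1 = 1.
Proof.
have := crossed_mulR bP x 1 1; rewrite mulg1 gmulf1 conjg1 => /eqP.
by rewrite -{1}[b x 1]mulg1 => /eqP/mulgI.
Qed.

(** A state (x, y, u) stands for the product x y u in an extension of G x H by U
    where the commutator of x and y is b x y, and a letter acts by right
    multiplication.  Only this action is needed, so the group itself is never
    built. *)
Definition word_step (s : state) (l : G + H) : state :=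
  match l with
  | inl x => (s.1.1 * x, s.1.2, (b x s.1.2)^-1 * s.2 ^ j1 x)
  | inr y => (s.1.1, s.1.2 * y, s.2 ^ j2 y)
  end.

Lemma word_eq_foldl u v s : word_eq u v -> foldl word_step s u = foldl word_step s v.
Proof.
move=> uv; elim: uv s => {u v} [//|u v _ IH s|u v w _ IHu _ IHv s
  |u u' v v' _ IHu _ IHv s|s|x y s|s|x y s].
- by rewrite IH.
- by rewrite IHu.
- by rewrite !foldl_cat IHu IHv.
- by case: s => [[x y] u] /=; rewrite crossed_1l gmulf1 conjg1 mulg1 invg1 mul1g.
- case: s => [[x0 y0] u] /=; congr (_, _, _); first by rewrite mulgA.
  by rewrite (crossed_mulL bP) invgM conjMg gmulfM conjgM conjVg mulgA.
- by case: s => [[x y] u] /=; rewrite gmulf1 conjg1 mulg1.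
- by case: s => [[x0 y0] u] /=; rewrite mulgA gmulfM conjgM.
Qed.

Definition word_act (z : F) (s : state) : state := foldl word_step s (repr z).

Lemma word_act1 s : word_act 1 s = s.
Proof. exact: word_eq_foldl (word_sym (word_repr [::])). Qed.

Lemma word_actM z w s : word_act (z * w) s = word_act w (word_act z s).
Proof.
rewrite /word_act -foldl_cat; apply: word_eq_foldl.
exact: (word_sym (word_repr (repr z ++ repr w))).
Qed.

Lemma word_act_inl x s : word_act (i1 x) s = word_step s (inl x).
Proof. exact: (word_eq_foldl s (word_sym (word_repr [:: inl x]))). Qed.

Lemma word_act_inr y s : word_act (i2 y) s = word_step s (inr y).
Proof. exact: (word_eq_foldl s (word_sym (word_repr [:: inr y]))). Qed.

Lemma word_act_proj z s :
  (word_act z s).1 = (s.1.1 * proj_l G H z, s.1.2 * proj_r G H z).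
Proof.
elim/free_product_recr: z => [|z x IHz|z y IHz].
- by rewrite word_act1 !gmulf1 !mulg1; case: s => [[]].
- rewrite word_actM word_act_inl /= IHz /= !gmulfM proj_lE proj_r1 mulg1 mulgA //.
- rewrite word_actM word_act_inr /= IHz /= !gmulfM proj_l1 proj_rE mulg1 mulgA //.
Qed.

Lemma word_act_mem z s : U s.2 -> U (word_act z s).2.
Proof.
elim/free_product_recr: z => [|z x IHz|z y IHz] Us; first by rewrite word_act1.
  rewrite word_actM word_act_inl /=; apply: subgroupM; last exact/UJ1/IHz.
  exact: subgroupV.
by rewrite word_actM word_act_inr; exact/UJ2/IHz.
Qed.

Lemma commuting_act (f : state -> state) :
  (forall s l, f (word_step s l) = word_step (f s) l) ->
  forall z s, f (word_act z s) = word_act z (f s).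
Proof.
move=> fstep; elim/free_product_recr => [|z x IHz|z y IHz] s; rewrite ?word_act1 //.
  by rewrite !word_actM !word_act_inl fstep IHz.
by rewrite !word_actM !word_act_inr fstep IHz.
Qed.

(** Left multiplications by elements of U, G and H; they commute with the right
    action, which gives multiplicativity and equivariance. *)
Definition lmul_ker (u : E) (s : state) : state :=
  (s.1, u ^ (j1 s.1.1 * j2 s.1.2) * s.2).
Definition lmul_l (x : G) (s : state) : state := (x * s.1.1, s.1.2, s.2).
Definition lmul_r (y : H) (s : state) : state :=
  (s.1.1, y * s.1.2, (b s.1.1 y)^-1 ^ j2 s.1.2 * s.2).

Lemma lmul_l_step x s l : lmul_l x (word_step s l) = word_step (lmul_l x s) l.
Proof. by case: l => z; rewrite /lmul_l /= ?mulgA. Qed.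

(** Conjugations by x and y in either order differ by the action of b x y. *)
Lemma conj_swap u x y : U u ->
  u ^ (j2 y * j1 x) = b x y * u ^ (j1 x * j2 y) * (b x y)^-1.
Proof.
move=> Uu; have Uv : U (u ^ (j2 y * j1 x)) by rewrite conjgM; exact/UJ1/UJ2.
have := Ucomm x y Uv; rewrite -conjgM -commgC.
by move=> ->; rewrite conjgE !gnorm.
Qed.

Lemma lmul_ker_step u s l : U u -> lmul_ker u (word_step s l) = word_step (lmul_ker u s) l.
Proof.
case: s => [[x y] v] Uu; case: l => z; rewrite /lmul_ker /=; congr (_, _, _).
  have e : u ^ (j1 x * j2 y * j1 z) =
           b z y * u ^ (j1 x * j1 z * j2 y) * (b z y)^-1.
    rewrite -(mulgA (j1 x)) -(mulgA (j1 x) (j1 z)) !(conjgM u (j1 x)).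
    by apply: conj_swap; exact: UJ1.
  rewrite gmulfM conjMg -(conjgM u) e.
  by move: (u ^ _) (v ^ _) (b z y) => p q r; rewrite !gnorm.
by rewrite conjMg -(conjgM u) gmulfM [j1 x * (_ * _)]mulgA.
Qed.

Lemma lmul_r_step y s l : lmul_r y (word_step s l) = word_step (lmul_r y s) l.
Proof.
case: s => [[x w] v]; case: l => z; rewrite /lmul_r /=; last first.
  by rewrite gmulfM conjMg conjgM mulgA.
congr (_, _, _).
have e : (b x y ^ (j2 w * j1 z))^-1 =
         b z w * (b x y ^ (j1 z * j2 w))^-1 * (b z w)^-1.
  by rewrite -!conjVg; apply: conj_swap; exact: subgroupV.
rewrite (crossed_mulL bP) (crossed_mulR bP) (conjVg (_ * _)) (conjMg (b x y ^ j1 z)).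
rewrite (conjMg ((b x y)^-1 ^ _)) (conjVg (b x y)) (conjVg (b x y ^ _)) -!(conjgM (b x y)).
rewrite e; move: (_ ^ (j1 z * _)) (_ ^ j2 w) (v ^ _) (b z w) => p1 p2 p3 p4.
by rewrite !gnorm.
Qed.

Definition extension (z : F) : E := (word_act z (1, 1, 1)).2.

Lemma word_act_cartesian d : D d -> word_act d (1, 1, 1) = (1, 1, extension d).
Proof.
move=> /cartesianP[d1 d2]; rewrite /extension.
have := word_act_proj d (1, 1, 1); rewrite d1 d2 !mulg1.
by case: (word_act d _) => [s u] /= ->.
Qed.

Lemma extension_mem z : U (extension z).
Proof. by apply: word_act_mem; exact: subgroup1. Qed.

Lemma extensionM d d' : D d -> D d' ->
  extension (d * d') = extension d * extension d'.
Proof.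
move=> Dd Dd'.
have e : (1, 1, extension d) = lmul_ker (extension d) (1, 1, 1).
  by rewrite /lmul_ker /= !gmulf1 !mulg1 conjg1.
rewrite {1}/extension word_actM word_act_cartesian // e -commuting_act; last first.
  by move=> s l; apply: lmul_ker_step; exact: extension_mem.
by rewrite word_act_cartesian // /lmul_ker /= !gmulf1 mulg1 conjg1.
Qed.

Lemma extensionJ d z : D d ->
  extension (d ^ z) = extension d ^ copair j1 j2 z.
Proof.
move=> Dd; elim/free_product_recr: z => [|z x IHz|z y IHz].
- by rewrite gmulf1 !conjg1.
- rewrite gmulfM copair_inl !conjgM -IHz; move: (d ^ z) (normalP z Dd) => c Dc.
  rewrite conjgE -gmulfV {1}/extension !word_actM !word_act_inl.
  have -> : word_step (1, 1, 1) (inl x^-1) = lmul_l x^-1 (1, 1, 1).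
    by rewrite /lmul_l /= crossed_1r conj1g invg1 !mulg1 mul1g.
  rewrite -(commuting_act (lmul_l_step _)) word_act_cartesian //=.
  by rewrite crossed_1r invg1 mul1g.
- rewrite gmulfM copair_inr !conjgM -IHz; move: (d ^ z) (normalP z Dd) => c Dc.
  rewrite conjgE -gmulfV {1}/extension !word_actM !word_act_inr.
  have -> : word_step (1, 1, 1) (inr y^-1) = lmul_r y^-1 (1, 1, 1).
    by rewrite /lmul_r /= crossed_1l conj1g invg1 conj1g !mulg1 mul1g.
  rewrite -(commuting_act (lmul_r_step _)) word_act_cartesian //=.
  by rewrite crossed_1l invg1 conj1g mul1g.
Qed.

Lemma extension_comm x y : extension [~ i1 x, i2 y] = b x y.
Proof.
rewrite /extension /commg /conjg -!gmulfV !word_actM !word_act_inl !word_act_inr /=.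
rewrite crossed_1r !mul1g invg1 mul1g !conj1g mulg1.
have := crossed_mulR bP x y^-1 y; rewrite mulVg crossed_1r => /esym/eqP.
by rewrite mulg_eq1 -conjVg => /eqP.
Qed.

(** The universal property of the cartesian subgroup as a crossed module over
    the free product: an element d of D sends the neutral state to a state
    whose last component is the value at d. *)
Theorem crossed_pairing_extension : exists Phi : F -> E,
  [/\ forall d d', D d -> D d' -> Phi (d * d') = Phi d * Phi d',
      forall d z, D d -> Phi (d ^ z) = Phi d ^ copair j1 j2 z,
      forall x y, Phi [~ i1 x, i2 y] = b x y &
      forall z, U (Phi z)].
Proof.
by exists extension; split; [exact: extensionM|exact: extensionJ|
  exact: extension_comm|exact: extension_mem].
Qed.

End CrossedPairing.

(** * Lifting a pairing through a central extension *)

Section Lifting.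
Local Open Scope classical_set_scope.
Local Open Scope group_scope.

(** In the application, K and L act on V through j1 and j2, T is the central
    overlap, and b0 is a choice of lifts of commutators that is multiplicative
    up to T. *)
Section CrossedPairingLift.
Variables (K L G H E : groupType).
Variables (p1 : group_hom K G) (p2 : group_hom L H).
Variables (j1 : group_hom K E) (j2 : group_hom L E).
Variables (T V : subgroup E) (b0 : G -> H -> E).

Hypothesis p1_surj : forall g, exists x, p1 x = g.
Hypothesis p2_surj : forall h, exists y, p2 y = h.
Hypothesis T_central : forall t e, T t -> commute t e.
Hypothesis V_b0 : forall g h, V (b0 g h).
Hypothesis VJ1 : forall v x, V v -> V (v ^ j1 x).
Hypothesis VJ2 : forall v y, V v -> V (v ^ j2 y).
Hypothesis V_act1 : forall v x x', V v -> p1 x = p1 x' -> v ^ j1 x = v ^ j1 x'.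
Hypothesis V_act2 : forall v y y', V v -> p2 y = p2 y' -> v ^ j2 y = v ^ j2 y'.
Hypothesis V_comm : forall v x y, V v ->
  v ^ [~ j1 x, j2 y] = v ^ b0 (p1 x) (p2 y).
Hypothesis b0_mulL : forall g x h,
  T ((b0 (g * p1 x) h)^-1 * (b0 g h ^ j1 x * b0 (p1 x) h)).
Hypothesis b0_mulR : forall g h y,
  T ((b0 g (h * p2 y))^-1 * (b0 g (p2 y) * b0 g h ^ j2 y)).

(** The defects f and k of b0 in each variable are 2-cocycles, and the two ways
    to expand b0 (g g') (h h') give the coupling between them; a cochain that
    bounds both corrects b0. *)
Lemma crossed_pairing_lift a b nG nH :
  kills_ab G a -> kills_ab H b -> kills_H2 G nG -> kills_H2 H nH ->
  coprime a b -> coprime nG b -> coprime a nH ->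
  exists2 beta : G -> H -> E,
    forall g h, T ((b0 g h)^-1 * beta g h) &
    crossed_pairing j1 j2 (fun x y => beta (p1 x) (p2 y)).
Proof.
move=> Ga Hb GnG HnH ab nGb anH.
have cT : abelian_group (subgroup_type T).
  by move=> u v; apply: val_inj; rewrite !gmulfM; apply: T_central; exact: subgroup_eltP.
pose ev (u : additive_group cT) : E := val (u : subgroup_type T).
have evD (u v : additive_group cT) : ev (u + v)%R = ev u * ev v :> E.
  exact: (@gmulfM _ _ (val : subgroup_type T -> E)).
have evN (u : additive_group cT) : ev (- u)%R = (ev u)^-1 :> E.
  exact: (@gmulfV _ _ (val : subgroup_type T -> E)).
have ev_inj : injective ev by exact: val_inj.
have cen (u : additive_group cT) e : commute (ev u) e.
  by apply: T_central; exact: subgroup_eltP.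
have cenJ (u : additive_group cT) e : ev u ^ e = ev u by exact: commute_conjg.
have /choice[s1 s1E] := p1_surj; have /choice[s2 s2E] := p2_surj.
have fT g g' h : T ((b0 (g * g') h)^-1 * (b0 g h ^ j1 (s1 g') * b0 g' h)).
  by have := b0_mulL g (s1 g') h; rewrite s1E.
have kT g h h' : T ((b0 g (h * h'))^-1 * (b0 g h' * b0 g h ^ j2 (s2 h'))).
  by have := b0_mulR g h (s2 h'); rewrite s2E.
pose f g g' h : additive_group cT := subgroup_elt (fT g g' h).
pose k g h h' : additive_group cT := subgroup_elt (kT g h h').
have fE g x h : b0 g h ^ j1 x * b0 (p1 x) h = b0 (g * p1 x) h * ev (f g (p1 x) h).
  by rewrite /= mulVKg (@V_act1 _ (s1 (p1 x)) x).
have kE g h y : b0 g (p2 y) * b0 g h ^ j2 y = b0 g (h * p2 y) * ev (k g h (p2 y)).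
  by rewrite /= mulVKg (@V_act2 _ (s2 (p2 y)) y).
have evT u : T (ev u) by exact: subgroup_eltP.
(* From here on the defects are used only through fE and kE; unfolding them
   would make rewriting match inside their definitions. *)
clearbody f k ev.
have fc h : cocycle2 (fun g g' => f g g' h).
  move=> g g' g''; apply: ev_inj; rewrite !evD -(s1E g') -(s1E g'').
  move: (s1 g') (s1 g'') => x x'; apply: (mulgI (b0 (g * p1 x * p1 x') h)).
  transitivity ((b0 g h ^ j1 x * b0 (p1 x) h) ^ j1 x' * b0 (p1 x') h).
    rewrite fE conjMg cenJ -[RHS]mulgA [ev _ * b0 _ _]cen [RHS]mulgA fE -[RHS]mulgA.
    by congr (_ * _); exact: cen.
  rewrite conjMg -conjgM -gmulfM -[LHS]mulgA fE -gmulfM [LHS]mulgA fE !gmulfM.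
  by rewrite (mulgA g) -[LHS]mulgA; congr (_ * _); exact: cen.
have kc g : cocycle2 (k g).
  move=> h h' h''; apply: ev_inj; rewrite !evD -(s2E h') -(s2E h'').
  move: (s2 h') (s2 h'') => y y'; apply: (mulgI (b0 g (h * p2 y * p2 y'))).
  transitivity (b0 g (p2 y') * (b0 g (p2 y) * b0 g h ^ j2 y) ^ j2 y').
    rewrite kE conjMg cenJ [RHS]mulgA kE -[RHS]mulgA.
    by congr (_ * _); exact: cen.
  rewrite conjMg -conjgM -gmulfM [LHS]mulgA kE -gmulfM -[LHS]mulgA.
  rewrite [ev _ * _ ^ _]cen [LHS]mulgA.
  rewrite kE !gmulfM (mulgA h) -[LHS]mulgA.
  by congr (_ * _); exact: cen.
have fk h h' g g' : (f g g' h + f g g' h' - f g g' (h * h')%g =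
                    cobound (fun x => k x h h') g g')%R.
  suff e : (f g g' h + f g g' h' + k (g * g')%g h h' =
            k g h h' + k g' h h' + f g g' (h * h')%g)%R.
    by apply: (eq_by e); rewrite /cobound; zmod.
  apply: ev_inj; rewrite !evD -(s1E g') -(s2E h').
  move: (s1 g') (s2 h') => x y; apply: (mulgI (b0 (g * p1 x) (h * p2 y))).
  transitivity (b0 g (p2 y) ^ j1 x * b0 (p1 x) (p2 y) *
                (b0 g h ^ j1 x * b0 (p1 x) h) ^ j2 y).
    rewrite !fE conjMg cenJ [RHS]mulgA -[_ * ev _ * _ ^ _]mulgA [ev _ * _ ^ _]cen.
    rewrite [X in _ = X * _]mulgA kE -!(mulgA (b0 _ _)); congr (_ * _).
    by rewrite -[LHS]mulgA [LHS]cen; congr (_ * _); exact: cen.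
  transitivity ((b0 g (p2 y) * b0 g h ^ j2 y) ^ j1 x *
                (b0 (p1 x) (p2 y) * b0 (p1 x) h ^ j2 y)); last first.
    apply: esym; rewrite !kE conjMg cenJ [RHS]mulgA -[_ * ev _ * b0 _ _]mulgA [ev _ * b0 _ _]cen.
    rewrite [X in _ = X * _]mulgA fE -!(mulgA (b0 _ _)); congr (_ * _).
    by rewrite -[RHS]mulgA; exact: (esym (cen _ _)).
  have e : b0 (p1 x) (p2 y) * (b0 g h ^ j1 x) ^ j2 y =
           (b0 g h ^ j2 y) ^ j1 x * b0 (p1 x) (p2 y).
    have Vv : V ((b0 g h ^ j2 y) ^ j1 x) by exact/VJ1/VJ2.
    by rewrite [RHS]conjgC -V_comm // -!(conjgM (b0 g h)) -commgC.
  rewrite (conjMg (b0 g h ^ _)) (conjMg (b0 g (p2 y))) -[LHS]mulgA -[RHS]mulgA.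
  by congr (_ * _); rewrite mulgA e -mulgA.
have [t [tf tk]] := kunneth_coboundary Ga Hb GnG HnH ab nGb anH fc kc fk.
exists (fun g h => b0 g h * (ev (t g h))^-1) => [g h|].
  by rewrite mulKg; apply: subgroupV; exact: evT.
split=> [x x' y|x y y'].
  rewrite gmulfM -!evN conjMg cenJ [RHS]mulgA -[_ * ev _ * b0 _ _]mulgA.
  rewrite [ev _ * b0 _ _]cen [X in _ = X * _]mulgA fE -!(mulgA (b0 _ _)).
  by congr (_ * _); rewrite -!evD tf /cobound; congr ev; zmod.
rewrite gmulfM -!evN conjMg cenJ [RHS]mulgA -[_ * ev _ * _ ^ _]mulgA.
rewrite [ev _ * _ ^ _]cen [X in _ = X * _]mulgA kE -!(mulgA (b0 _ _)).
by congr (_ * _); rewrite -!evD tk /cobound; congr ev; zmod.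
Qed.

End CrossedPairingLift.
End Lifting.

(** * The cartesian part of the multiplier vanishes *)

Section Main.
Local Open Scope classical_set_scope.
Local Open Scope group_scope.

Section CartesianMultiplier.
Variables (K L G H : groupType).
Variables (p1 : group_hom K G) (p2 : group_hom L H).
Hypothesis p1_surj : forall g, exists x, p1 x = g.
Hypothesis p2_surj : forall h, exists y, p2 y = h.
Variables a b nG nH : nat.
Hypotheses (Ga : kills_ab G a) (Hb : kills_ab H b).
Hypotheses (GnG : kills_H2 G nG) (HnH : kills_H2 H nH).
Hypotheses (ab : coprime a b) (nGb : coprime nG b) (anH : coprime a nH).

Local Notation F := (free_product K L).
Local Notation i1 := (inl_hom K L).
Local Notation i2 := (inr_hom K L).
Local Notation D := (cartesian K L).
Local Notation P := (free_product_map p1 p2).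
Local Notation S := (kernel P).
Local Notation S_ k := (iter_comm S k).
Local Notation D_ k := (iter_comm D k).

Lemma map_commE x y :
  P [~ i1 x, i2 y] = [~ inl_hom G H (p1 x), inr_hom G H (p2 y)].
Proof. by rewrite gmulfR free_product_mapl free_product_mapr. Qed.

Section Step.
Variable k : nat.
Hypothesis IHk : forall w, D w -> S w -> lower_central F k.+2 w -> S_ k.+1 w.

Let q := quotient_hom (S_ k.+2).
Let j1 : group_hom K (quotient (S_ k.+2)) := q \o i1.
Let j2 : group_hom L (quotient (S_ k.+2)) := q \o i2.

Lemma j_commE x y : [~ j1 x, j2 y] = q [~ i1 x, i2 y].
Proof. by rewrite gmulfR. Qed.

Lemma image_is_subgroup (A : subgroup F) :
  is_subgroup [set e | exists2 x, A x & q x = e].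
Proof.
split=> [|_ _ [x Ax <-] [y Ay <-]].
  by exists 1; [exact: subgroup1|rewrite gmulf1].
by exists (x / y); [exact: subgroupF|rewrite gmulfF].
Qed.

Let img (A : subgroup F) := Subgroup (image_is_subgroup A).

Lemma image_conj (A : normal_subgroup F) e z : img A e -> img A (e ^ q z).
Proof. by move=> [x Ax <-]; exists (x ^ z); [exact: normalP|rewrite gmulfJ]. Qed.

Lemma commute_S_D s v : S s -> D_ k.+1 v -> commute (q s) (q v).
Proof.
move=> Ss Dv; apply/quotient_hom_commute; apply: lower_central_comm => //.
by have [] := iter_comm_sub Dv.
Qed.

(** This is where the induction on the class is used. *)
Lemma overlap_central t z : S t -> D_ k.+1 t -> commute (q t) (q z).
Proof.
move=> St Dt; apply/quotient_hom_commute; apply: comm_gen => //; apply: IHk => //.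
  exact: iter_comm_subl Dt.
by have [] := iter_comm_sub Dt.
Qed.

(** By [cartesian_split] a commutator of lifts is the product of an element of S
    and an element of V. *)
Lemma pairing_rep g h : exists v,
  D_ k.+1 v /\ P v = [~ inl_hom G H g, inr_hom G H h].
Proof.
have [[x <-] [y <-]] := (p1_surj g, p2_surj h).
have [s Ss Dv] := cartesian_split p1_surj p2_surj (k.+1) Ga Hb ab
  (cartesian_comm x y).
exists (s^-1 * [~ i1 x, i2 y]); split=> //.
have Ps : P s = 1 by exact: (comm_subl Ss).
by rewrite gmulfM gmulfV Ps invg1 mul1g map_commE.
Qed.

Lemma crossed_pairing_to_D : exists2 beta : G -> H -> quotient (S_ k.+2),
  forall g h, exists v, [/\ D_ k.+1 v, q v = beta g h &
                            P v = [~ inl_hom G H g, inr_hom G H h]] &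
  crossed_pairing j1 j2 (fun x y => beta (p1 x) (p2 y)).
Proof.
have /choice[v0 v0P] (gh : G * H) := pairing_rep gh.1 gh.2.
pose v g h := v0 (g, h).
have Dv g h : D_ k.+1 (v g h) by case: (v0P (g, h)).
have Pv g h : P (v g h) = [~ inl_hom G H g, inr_hom G H h] by case: (v0P (g, h)).
pose V := img (D_ k.+1); pose T := img (meet S (D_ k.+1)).
have act z z' w : D_ k.+1 w -> P z = P z' -> q w ^ q z = q w ^ q z'.
  move=> Dw e; rewrite -[z'](mulVKg z) gmulfM conjgM.
  apply/esym/commute_conjg; rewrite -gmulfJ; apply: commute_sym.
  apply: commute_S_D; last exact: normalP.
  by change (P (z^-1 * z') = 1); rewrite gmulfM gmulfV e mulVg.
have Tv w w' : D_ k.+1 w -> D_ k.+1 w' -> P w = P w' -> T ((q w)^-1 * q w').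
  move=> Dw Dw' e; exists (w^-1 * w'); last by rewrite gmulfM gmulfV.
  split; last by apply: subgroupM => //; exact: subgroupV.
  by change (P (w^-1 * w') = 1); rewrite gmulfM gmulfV e mulVg.
have [|||||||||beta Tbeta betaP] := @crossed_pairing_lift K L G H _ p1 p2 j1 j2
    T V (fun g h => q (v g h)) p1_surj p2_surj
    _ _ _ _ _ _ _ _ _ a b nG nH Ga Hb GnG HnH ab nGb anH.
- move=> t e [x [Sx Dx] <-]; have [z <-] := quotient_hom_surj e.
  exact: overlap_central.
- by move=> g h; exists (v g h).
- by move=> w x; exact: image_conj.
- by move=> w y; exact: image_conj.
- move=> _ x x' [w Dw <-] e; apply: act => //.
  by rewrite !free_product_mapl e.
- move=> _ y y' [w Dw <-] e; apply: act => //.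
  by rewrite !free_product_mapr e.
- move=> _ x y [w Dw <-]; rewrite j_commE; apply: act => //.
  by rewrite map_commE Pv.
- move=> g x h; rewrite -[_ ^ _](@gmulfJ _ _ q) -gmulfM; apply: Tv => //.
    by apply: subgroupM => //; exact: normalP.
  by rewrite gmulfM gmulfJ !Pv free_product_mapl gmulfM commg_mulgL.
- move=> g h y; rewrite -[_ ^ _](@gmulfJ _ _ q) -gmulfM; apply: Tv => //.
    by apply: subgroupM => //; exact: normalP.
  by rewrite gmulfM gmulfJ !Pv free_product_mapr gmulfM commg_mulgR.
exists beta => // g h; have [t [St Dt] et] := Tbeta g h.
exists (v g h * t); split; first exact: subgroupM.
  by rewrite gmulfM et mulVKg.
by rewrite gmulfM Pv (_ : P t = 1) ?mulg1.
Qed.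

(** Phi is the homomorphism on D that extends (x, y) |-> [x, y] beta(x, y)^-1:
    it is the quotient map on the intersection of D and S, and it is trivial on
    D_(k+1). *)
Lemma cartesian_multiplier_step w :
  D w -> S w -> lower_central F k.+3 w -> S_ k.+2 w.
Proof.
have [beta betaV betaP] := crossed_pairing_to_D.
pose b' x y := [~ j1 x, j2 y] * (beta (p1 x) (p2 y))^-1.
pose U := img (comm S whole).
have UV u v : U u -> D_ k.+1 v -> commute u (q v).
  by move=> [s Ss <-] Dv; apply: commute_S_D => //; exact: comm_subl Ss.
have Ub x y : U (b' x y).
  have [v [Dv ev Pv]] := betaV (p1 x) (p2 y).
  exists ([~ i1 x, i2 y] / v); last by rewrite gmulfF gmulfR ev.
  apply: (cartesian_kernel p1_surj p2_surj).
    by change (P ([~ i1 x, i2 y] / v) = 1); rewrite gmulfF map_commE Pv mulgV.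
  apply: subgroupF; first exact: cartesian_comm.
  exact: iter_comm_subl Dv.
have UJ1 u x : U u -> U (u ^ j1 x) by exact: image_conj.
have UJ2 u y : U u -> U (u ^ j2 y) by exact: image_conj.
have b'E x y : [~ j1 x, j2 y] = b' x y * beta (p1 x) (p2 y) by rewrite mulgVK.
have quot_mul u1 v1 u2 v2 : commute u2 v1 ->
    u1 * v1 * (u2 * v2) * (v1 * v2)^-1 = u1 * u2 :> quotient (S_ k.+2).
  by move=> c; rewrite !gnorm -(mulgA u1) -c !gnorm.
have b'P : crossed_pairing j1 j2 b'.
  split=> [x x' y|x y y'].
    rewrite {1}/b' gmulfM commg_mulgL (crossed_mulL betaP) !b'E conjMg.
    apply: quot_mul; have [v [Dv <- _]] := betaV (p1 x) (p2 y).
    by rewrite -(@gmulfJ _ _ q); apply: UV => //; exact: normalP.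
  rewrite {1}/b' gmulfM commg_mulgR (crossed_mulR betaP) !b'E conjMg.
  apply: quot_mul; have [v [Dv <- _]] := betaV (p1 x) (p2 y').
  by apply: UV => //; exact: UJ2.
have Ucomm u x y : U u -> u ^ [~ j1 x, j2 y] = u ^ b' x y.
  move=> Uu; rewrite b'E conjgM; apply: commute_conjg.
  have [v [Dv <- _]] := betaV (p1 x) (p2 y); apply: UV => //.
  by have [z <-] := quotient_hom_surj (b' x y); exact: image_conj.
have [Phi [PhiM PhiJ Phib PhiU]] := crossed_pairing_extension b'P Ub UJ1 UJ2 Ucomm.
have jE z : copair j1 j2 z = q z.
  apply: (eq_hom_free_product (f := copair j1 j2)) => x.
    by rewrite copair_inl.
  by rewrite copair_inr.
have PhiV d : D d -> Phi d^-1 = (Phi d)^-1.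
  move=> Dd; have D1 := subgroup1 D.
  have Phi1 : Phi 1 = 1.
    by apply: (mulgI (Phi 1)); rewrite -PhiM // !mulg1.
  by apply/esym/mulg1_eq; rewrite -PhiM ?mulgV //; exact: subgroupV.
have PhiF d d' : D d -> D d' -> Phi (d / d') = Phi d / Phi d'.
  by move=> Dd Dd'; rewrite PhiM ?PhiV //; exact: subgroupV.
(* The elements where Phi is the quotient map form a normal subgroup, which
   contains the generators of the intersection of D and S: there beta is 1. *)
pose fixed := [set d | D d /\ Phi d = q d].
have fixed_subgroup : is_subgroup fixed.
  split=> [|d d' [Dd ed] [Dd' ed']].
    split; first exact: subgroup1.
    by rewrite -(mulgV 1) PhiF ?gmulfF ?mulgV //; exact: subgroup1.
  by split; [exact: subgroupF|rewrite PhiF // ed ed' gmulfF].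
have fixed_conj d z : fixed d -> fixed (d ^ z).
  move=> [Dd ed]; split; first exact: normalP.
  by rewrite PhiJ // ed jE gmulfJ.
pose N := @NormalSubgroup _ (Subgroup fixed_subgroup) fixed_conj.
have fixedS z : S z -> D z -> Phi z = q z.
  move=> Sz Dz; suff: N z by case.
  move: z Sz Dz; apply: (cartesian_kernel_generation p1_surj p2_surj) => [r y p1r|x r p2r].
    split; first exact: cartesian_comm.
    rewrite Phib /b' p1r; have := crossed_1l betaP y; rewrite gmulf1 => ->.
    rewrite invg1 mulg1.
    exact: j_commE.
  split; first exact: cartesian_comm.
  rewrite Phib /b' p2r; have := crossed_1r betaP x; rewrite gmulf1 => ->.
  rewrite invg1 mulg1.
  exact: j_commE.
(* Phi starts in S_1 and each commutator with F goes one step down, so level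
   k + 1 of D lands in S_(k+2), which is trivial in the quotient. *)
have deep i d : D_ i d -> exists2 s, S_ i.+1 s & Phi d = q s.
  elim: i d => [|i IHi] d; first by move=> _; have [s Ss <-] := PhiU d; exists s.
  move=> Dd; suff: D d /\ exists2 s, S_ i.+2 s & Phi d = q s by case.
  move: d Dd; apply: (comm_min (N := [set d | D d /\ exists2 s, S_ i.+2 s & Phi d = q s])).
    split=> [|d d' [Dd [s Ss ed]] [Dd' [s' Ss' ed']]].
      split; first exact: subgroup1.
      exists 1; first exact: subgroup1.
      by rewrite -(mulgV 1) PhiF ?gmulfF ?mulgV //; exact: subgroup1.
    split; first exact: subgroupF.
    exists (s / s'); first exact: subgroupF.
    by rewrite PhiF // ed ed' gmulfF.
  move=> d z Did _; have Dd : D d by exact: iter_comm_subl Did.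
  split; first exact: normalR.
  have [s Ss ed] := IHi d Did; exists [~ s, z]; first exact: comm_gen.
  rewrite commgEl PhiM ?PhiV ?PhiJ ?ed ?jE //; last exact: normalP.
    by rewrite gmulfR commgEl.
  exact: subgroupV.
move=> Dw Sw hw; apply/quotient_hom_eq1; rewrite -/q -fixedS //.
have [s Ss ->] := deep _ _ (cartesian_lower_central Dw hw).
exact/quotient_hom_eq1.
Qed.

End Step.
Theorem cartesian_multiplier k w :
  D w -> S w -> lower_central F k.+2 w -> S_ k.+1 w.
Proof.
elim: k w => [|k IHk] w; last exact: cartesian_multiplier_step.
by move=> Dw Sw _; exact: cartesian_kernel.
Qed.

End CartesianMultiplier.
End Main.

(** * The four cases *)

Section Conclusion.
Local Open Scope group_scope.

(** An infinite multiplier has order 0 by convention, and then there is nothing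
    to prove. *)
Lemma schur_multiplier_kills (G : groupType) (P : free_presentation G) r :
  pres_rel P r -> comm (@whole (pres_group P)) whole r ->
  comm (pres_rel P) whole (r ^+ group_order (schur_multiplier P)).
Proof.
move=> Rr r2; set M := schur_multiplier P.
have [finM|infM] := pselect (finite_group M); last first.
  have -> : group_order M = 0 by rewrite /group_order /fset_set; case: pselect => // _; exact: cardfs0.
  exact: subgroup1.
have cM : abelian_group M.
  move=> x y; have [[u <-] [v <-]] := (quotient_hom_surj x, quotient_hom_surj y).
  apply/quotient_hom_commute.
  change (comm (pres_rel P) whole (val [~ u, v])); rewrite gmulfR.
  by apply: comm_gen => //; have [] := subgroup_eltP u.
pose A := meet (pres_rel P) (lower_central (pres_group P) 2).
have Ar : A r by [].
pose q := quotient_hom (inner_subgroup A (iter_comm (pres_rel P) 1)).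
have e : q (subgroup_elt Ar) ^+ group_order M = 1.
  exact: (@finite_abelian_image M M idfun).
rewrite -gmulfXn in e; move/quotient_hom_eq1: e => e.
change (comm (pres_rel P) whole (val (subgroup_elt Ar ^+ group_order M))) in e.
by rewrite gmulfXn in e.
Qed.

Lemma kills_H2_0 (G : groupType) : kills_H2 G 0.
Proof. by move=> T k _; exists (fun _ => 0%R) => x y; rewrite /cobound mulr0n; zmod. Qed.

Lemma perfect_kills_ab (G : groupType) : perfect_group G -> kills_ab G 1.
Proof. by rewrite /perfect_group /kills_ab => -> x. Qed.

End Conclusion.

Theorem corollary4p3 (G H : groupType)
    (PG : free_presentation G) (PH : free_presentation H)
    (PGH : free_presentation (free_product G H)) :
  [\/ [/\ finite_group G, finite_group H, abelian_group G, abelian_group H &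
          coprime (group_order G) (group_order H)],
      [/\ finite_group G, finite_group H,
          coprime (group_order G) (group_order (abelianization H)) &
          coprime (group_order (abelianization G)) (group_order H)],
      [/\ finite_group G, finite_group H,
          coprime (group_order (abelianization G))
                  (group_order (abelianization H)),
          coprime (group_order (schur_multiplier PG))
                  (group_order (abelianization H)) &
          coprime (group_order (abelianization G))
                  (group_order (schur_multiplier PH))] |
      perfect_group G /\ perfect_group H] ->
  forall c : nat, 1 <= c ->
    isomorphic (nilpotent_multiplier c PGH)
               (nilpotent_multiplier c PG * nilpotent_multiplier c PH)%type.
Proof.
move=> cases [//|c] _.
suff [a [b [nG [nH [[Ga Hb] [GnG HnH] [ab nGb anH]]]]]] : exists a b nG nH,
    [/\ kills_ab G a /\ kills_ab H b, kills_H2 G nG /\ kills_H2 H nH &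
        [/\ coprime a b, coprime nG b & coprime a nH]].
  have [p1 [p1_surj kerp1]] := presentation_epi PG.
  have [p2 [p2_surj kerp2]] := presentation_epi PH.
  apply: (multiplier_retract PGH p1_surj p2_surj kerp1 kerp2) => w Dw Sw.
  exact: (cartesian_multiplier p1_surj p2_surj Ga Hb GnG HnH ab nGb anH).
case: cases => [[fG fH _ _ co]|[fG fH coG coH]|[fG fH co coG coH]|[pG pH]].
- exists (group_order G), (group_order H), (group_order G), (group_order H).
  by split; split=> //; by [exact: finite_kills_ab|exact: finite_kills_H2].
- exists (gcdn (group_order (abelianization G)) (group_order G)).
  exists (group_order (abelianization H)), (group_order G), (group_order H).
  split; split=> //; try exact: finite_kills_H2.
  + apply: kills_ab_gcd; last exact: finite_kills_ab.
    exact: abelianization_kills_ab.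
  + exact: abelianization_kills_ab.
  + exact: coprime_dvdl (dvdn_gcdr _ _) coG.
  + exact: coprime_dvdl (dvdn_gcdl _ _) coH.
- have Ga := abelianization_kills_ab fG; have Hb := abelianization_kills_ab fH.
  exists (group_order (abelianization G)), (group_order (abelianization H)).
  exists (group_order (schur_multiplier PG) * group_order (abelianization G))%N.
  exists (group_order (schur_multiplier PH) * group_order (abelianization H))%N.
  split; split=> //; rewrite ?coprimeMl ?coprimeMr ?co ?coG ?coH //.
    exact: presentation_kills_H2 Ga (@schur_multiplier_kills _ PG).
  exact: presentation_kills_H2 Hb (@schur_multiplier_kills _ PH).
- exists 1%N, 1%N, 0%N, 0%N.
  by split; split=> //; by [exact: perfect_kills_ab|exact: kills_H2_0].
Qed.
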